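(* Let $\kappa = (\alpha_1,\alpha_2,\ldots;\beta_1,\beta_2,\ldots;\gamma)$ be a Thoma parameter and let $N_\kappa \subset M_\kappa$ be the associated inclusion of von Neumann algebras. The following conditions are equivalent: (i) The inclusion $N_\kappa \subset M_\kappa$ is irreducible, i.e. $N_\kappa' \cap M_\kappa = \mathbb{C}$. (ii) One of the following conditions on $\kappa$ holds: (a) there exists an integer $n > 0$ such that $\kappa = (1/n,\ldots,1/n,0,0,\ldots;0,0,\ldots;0)$; (b) there exists an integer $n > 0$ such that $\kappa = (0,0,\ldots;1/n,\ldots,1/n,0,0,\ldots;0)$; (c) $\alpha_i = \beta_i = 0$ for every $i$ (hence $\gamma = 1$).
   Context: $S_\infty$ denotes the group of permutations of $\mathbb{N}=\{0,1,2,\ldots\}$ moving only finitely many elements, and $S_{1\le} \subset S_\infty$ is the subgroup of elements fixing $0$. $(m_1,\ldots,m_n)$ denotes the cyclic permutation $m_1\mapsto m_2\mapsto\cdots\mapsto m_n\mapsto m_1$. A Thoma parameter is $\kappa=(\alpha_1,\alpha_2,\ldots;\beta_1,\beta_2,\ldots;\gamma)$ consisting of two nonincreasing sequences $\alpha_1\ge\alpha_2\ge\cdots\ge 0$ and $\beta_1\ge\beta_2\ge\cdots\ge 0$ of real numbers and a real number $\gamma\ge 0$ with $\sum_{i=1}^\infty\alpha_i+\sum_{i=1}^\infty\beta_i+\gamma=1$. In (a) and (b), the value $1/n$ is repeated $n$ times. The function $\tau_\kappa$ on $S_\infty$ is defined by $\tau_\kappa(e)=1$, $\tau_\kappa(s)=\sum_{i=1}^\infty\bigl(\alpha_i^n-(-\beta_i)^n\bigr)$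 when $s$ is a cyclic permutation of $n\ge 2$ numbers, and $\tau_\kappa(s_0\cdots s_m)=\prod_k\tau_\kappa(s_k)$ when $s_0,\ldots,s_m$ are cyclic permutations with pairwise disjoint supports. It is positive definite and extends to an extremal tracial state $\tau_\kappa$ on the group C$^*$-algebra $C^*S_\infty$. Let $\pi_\kappa$ be the GNS representation of $\tau_\kappa$, let $M_\kappa=\pi_\kappa(S_\infty)''$, and let $N_\kappa\subset M_\kappa$ be the von Neumann subalgebra generated by $\pi_\kappa(S_{1\le})$. ($M_\kappa$ is a hyperfinite II$_1$ factor unless $\alpha_1=1$ or $\beta_1=1$, in which case $M_\kappa=N_\kappa=\mathbb{C}$.) *)

(* Defs.v *)
From HB Require Import structures.
From mathcomp Require Export all_boot all_order all_algebra.
From mathcomp Require Export sesquilinear complex finmap.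
From mathcomp Require Export all_classical all_reals all_analysis.
Export Order.TTheory GRing.Theory Num.Theory Num.Def.
Export numFieldNormedType.Exports.

Set Implicit Arguments.
Unset Strict Implicit.
Unset Printing Implicit Defensive.

Global Open Scope classical_set_scope.
Global Open Scope ring_scope.

Record finperm := FinPerm {
  finperm_fun :> nat -> nat;
  finperm_bij : bijective finperm_fun;
  finperm_supp : finite_set [set n | finperm_fun n != n] }.

HB.instance Definition _ := gen_eqMixin finperm.
HB.instance Definition _ := gen_choiceMixin finperm.

Lemma finpermP (s t : finperm) : s =1 t -> s = t.
Proof.
case: s t => [s sb sf] [t tb tf] /= /funext st; subst t.
by congr FinPerm; exact: Prop_irrelevance.
Qed.

Section FinpermGroup.

Fact finperm1_supp : finite_set [set n : nat | id n != n].
Proof. by apply: (@sub_finite_set _ _ set0) => // n /=; rewrite eqxx. Qed.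

Definition finperm1 : finperm :=
  FinPerm (Bijective (frefl id) (frefl id)) finperm1_supp.

Fact finpermM_supp (s t : finperm) : finite_set [set n | (s \o t) n != n].
Proof.
apply: (@sub_finite_set _ _ ([set n | s n != n] `|` [set n | t n != n])).
  move=> n /=; have [->|] := eqVneq (t n) n; first by left.
  by right.
by rewrite finite_setU; split; exact: finperm_supp.
Qed.

Definition finpermM (s t : finperm) : finperm :=
  FinPerm (bij_comp (finperm_bij s) (finperm_bij t)) (finpermM_supp s t).

Fact finpermV_ex (s : finperm) : exists t : finperm, cancel s t /\ cancel t s.
Proof.
have [g sK gK] := finperm_bij s.
have gsupp : finite_set [set n | g n != n].
  apply: sub_finite_set (finperm_supp s) => n /=; apply: contra_neq => sn.
  by rewrite -{1}sn sK.
by exists (FinPerm (Bijective gK sK) gsupp).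
Qed.

Definition finpermV (s : finperm) : finperm := projT1 (cid (finpermV_ex s)).

Fact finpermA : associative finpermM.
Proof. by move=> s t u; exact: finpermP. Qed.
Fact finperm1M : left_id finperm1 finpermM.
Proof. by move=> s; exact: finpermP. Qed.
Fact finpermM1 : right_id finperm1 finpermM.
Proof. by move=> s; exact: finpermP. Qed.
Fact finpermVM : left_inverse finperm1 finpermV finpermM.
Proof.
move=> s; apply: finpermP => n /=.
by rewrite /finpermV; case: cid => t /= [sK _]; exact: sK.
Qed.
Fact finpermMV : right_inverse finperm1 finpermV finpermM.
Proof.
move=> s; apply: finpermP => n /=.
by rewrite /finpermV; case: cid => t /= [_ tK]; exact: tK.
Qed.

End FinpermGroup.

(* The group S_oo: (s * t)%g n is s (t n). *)
HB.instance Definition _ := isGroup.Build finperm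
  finpermA finperm1M finpermM1 finpermVM finpermMV.

Lemma finpermME (s t : finperm) n : (s * t)%g n = s (t n). Proof. by []. Qed.

Lemma finperm_iter_moved (s : finperm) j n :
  s n != n -> s (iter j s n) != iter j s n.
Proof.
elim: j => // j IH /IH; rewrite iterS.
by apply: contra_neq => /(bij_inj (finperm_bij s)).
Qed.

Lemma finperm_iter_disj (s t : finperm) : (forall n, s n = n \/ t n = n) ->
  forall n, s n != n -> forall j, iter j (s * t)%g n = iter j s n.
Proof.
move=> st n sn; elim=> // j IH; rewrite !iterS {}IH.
have := finperm_iter_moved j sn.
case: (st (iter j s n)) => [->|]; first by rewrite eqxx.
by move=> tn _; rewrite finpermME tn.
Qed.

Lemma finperm_disjC (s t : finperm) :
  (forall n, s n = n \/ t n = n) -> (s * t = t * s)%g.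
Proof.
move=> st; apply: finpermP => n.
rewrite !finpermME.
case: (eqVneq (s n) n) => [sn|sn]; last first.
  have -> : t n = n by case: (st n) => // e; rewrite e eqxx in sn.
  by have := finperm_iter_moved 1 sn; case: (st (s n)) => //= ->; rewrite ?eqxx.
rewrite sn; case: (eqVneq (t n) n) => [-> //|tn].
by have := finperm_iter_moved 1 tn; case: (st (t n)) => //= ->; rewrite ?eqxx.
Qed.

Definition stab0 : set finperm := [set s | s 0%N = 0%N].

(* Indices start at 0: alpha i and beta i stand for the usual alpha_(i+1) and
   beta_(i+1).  The sums are taken in the extended reals, so that the last
   field also asserts their convergence. *)
Record thoma_param (R : realType) := ThomaParam {
  alpha : nat -> R;
  beta : nat -> R;
  gamma : R;
  alpha_noninc : nonincreasing_seq alpha;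
  beta_noninc : nonincreasing_seq beta;
  alpha_ge0 : forall i, 0 <= alpha i;
  beta_ge0 : forall i, 0 <= beta i;
  gamma_ge0 : 0 <= gamma;
  thoma_sum : (\sum_(0 <= i <oo) (alpha i)%:E + \sum_(0 <= i <oo) (beta i)%:E
               + gamma%:E = 1)%E }.

Section ThomaCharacter.
Variables (R : realType) (k : thoma_param R).

Definition thoma_cycle (n : nat) : R :=
  limn (series (fun i => alpha k i ^+ n - (- beta k i) ^+ n)).

(* The supports of the cycles of length at least 2 in the decomposition of s
   into disjoint cycles, i.e. the orbits of s on the points it moves. *)
Definition cycle_supports (s : finperm) : set (set nat) :=
  [set [set iter j s n | j in [set: nat]] | n in [set n | s n != n]].

Definition thoma_char (s : finperm) : R :=
  \big[*%R/1]_(O \in cycle_supports s) thoma_cycle #|` fset_set O|%fset.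

End ThomaCharacter.

(* The next three lemmas determine thoma_char: every s is a product of cycles
   with disjoint supports. *)
Section ThomaCharacterTheory.
Variables (R : realType) (k : thoma_param R).

Lemma thoma_char1 : thoma_char k 1%g = 1.
Proof.
rewrite /thoma_char (_ : cycle_supports 1%g = set0) ?fsbig_set0//.
by apply/seteqP; split=> // O [n /=]; rewrite eqxx.
Qed.

Lemma thoma_charM (s t : finperm) : (forall n, s n = n \/ t n = n) ->
  thoma_char k (s * t)%g = thoma_char k s * thoma_char k t.
Proof.
move=> st.
have ts : forall n, t n = n \/ s n = n by move=> n; case: (st n); [right|left].
have fin (u : finperm) : finite_set (cycle_supports u).
  exact/finite_image/finperm_supp.
rewrite /thoma_char -fsbigU; [|exact: fin|exact: fin|].
- congr (\big[*%R/1]_(O \in _) _); apply/seteqP; split=> O.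
    move=> [n stn <-]; have {}stn : s (t n) != n := stn.
    have [sn|sn] := eqVneq (s n) n.
      have tn : t n != n.
        apply: contra_neq stn => tn.
        by rewrite tn sn.
      right; exists n; first exact: tn.
      apply: eq_imagel => j _.
      by rewrite finperm_disjC // finperm_iter_disj.
    left; exists n; first exact: sn.
    apply: eq_imagel => j _.
    by rewrite finperm_iter_disj.
  case=> -[n un <-]; exists n.
  + suff: iter 1 (s * t)%g n != n by [].
    by rewrite finperm_iter_disj.
  + by apply: eq_imagel => j _; rewrite finperm_iter_disj.
  + suff: iter 1 (s * t)%g n != n by [].
    by rewrite finperm_disjC // finperm_iter_disj.
  + by apply: eq_imagel => j _; rewrite finperm_disjC // finperm_iter_disj.
- move=> O [[n /= sn <-] [m /= tm e]]; exfalso.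
  have : [set iter j t m | j in setT] n by rewrite e; exists 0%N.
  move=> [j _ jn]; have := finperm_iter_moved j tm; rewrite jn.
  by case: (st n) => e'; [move/eqP: sn|rewrite e' eqxx].
Qed.

Lemma thoma_char_cycle (s : finperm) (c : seq nat) :
  uniq c -> (1 < size c)%N -> fcycle s c -> (forall n, n \notin c -> s n = n) ->
  thoma_char k s = thoma_cycle k (size c).
Proof.
move=> uc c1 cc fx.
have mov n : n \in c -> s n != n.
  move=> nc; have e := eqP (next_cycle cc nc); rewrite e.
  case/rot_to: nc => i p rc.
  rewrite -(next_rot i) // rc; move: c1 uc; rewrite -(size_rot i) -(rot_uniq i) rc.
  case: p {rc} => //= m p _; rewrite inE negb_or eqxx => /andP[/andP[nm _] _].
  by rewrite eq_sym.
have orb n : n \in c -> [set iter j s n | j in setT] = [set` c].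
  move=> nc; apply/seteqP; split=> [_ [j _ <-]|m /= mc].
    elim: j => //= j IH; rewrite (eqP (next_cycle cc IH)).
    by rewrite mem_next.
  case/rot_to: nc => i p rc.
  have := cc; rewrite -(rot_cycle i) rc /= rcons_path => /andP[/fpathP[r e] _].
  have : m \in n :: p by rewrite -rc mem_rot.
  rewrite e -trajectS => /trajectP[j _ ->]; by exists j.
rewrite /thoma_char (_ : cycle_supports s = [set [set` c]]).
  rewrite fsbig_set1; congr thoma_cycle.
  rewrite (_ : [set` c] = [set` [fset x in c]%fset]); last first.
    by apply/seteqP; split => x /=; rewrite !inE.
  by rewrite set_fsetK card_fseq undup_id.
apply/seteqP; split=> [A [n /= sn <-]|A ->].
  rewrite orb //; apply: contraNT sn => /fx ->; by rewrite eqxx.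
move: c1 {cc fx uc}; case: c orb mov => // n c orb mov _; exists n => /=.
  by apply: mov; rewrite inE eqxx.
by rewrite orb // inE eqxx.
Qed.

End ThomaCharacterTheory.

Section Operators.
Variables (R : realType) (H : completeNormedModType R[i]).
Variable dot : {dot H for conjC}.

Definition bounded_operator (T : H -> H) : Prop := linear T /\ continuous T.

Definition commutant (A : set (H -> H)) : set (H -> H) :=
  [set T | bounded_operator T /\ forall S, A S -> T \o S = S \o T].

Definition adjoint_closed (A : set (H -> H)) : Prop :=
  forall T, A T -> exists2 S, A S & forall x y, dot (T x) y = dot x (S y).

Definition von_neumann_algebra (A : set (H -> H)) : Prop :=
  adjoint_closed A /\ commutant (commutant A) = A.

Definition scalar_operators : set (H -> H) :=
  [set T | exists c : R[i], T = (fun x => c *: x)].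

(* A form {dot H for conjC} is linear in its first argument. *)
Definition hilbert_dot : Prop := forall x, dot x x = `|x| ^+ 2.

Definition unitary_rep (pi : finperm -> H -> H) : Prop :=
  [/\ forall s, linear (pi s),
      forall s x y, dot (pi s x) (pi s y) = dot x y,
      pi 1%g = id &
      forall s t, pi (s * t)%g = pi s \o pi t].

Definition linear_span (A : set H) : set H :=
  [set x | exists (m : nat) (c : 'I_m -> R[i]) (v : 'I_m -> H),
     (forall j, A (v j)) /\ x = \sum_j c j *: v j].

(* (H, pi, xi) is the GNS triple of tau, which is unique up to unitary
   equivalence. *)
Definition GNS_triple (tau : finperm -> R) (pi : finperm -> H -> H) (xi : H)
    : Prop :=
  [/\ hilbert_dot, unitary_rep pi,
      dense (linear_span (range (pi ^~ xi))) &
      forall s, dot (pi s xi) xi = (tau s)%:C%C].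

Definition M_alg (pi : finperm -> H -> H) : set (H -> H) :=
  commutant (commutant (range pi)).

Definition N_alg (pi : finperm -> H -> H) : set (H -> H) :=
  smallest von_neumann_algebra (pi @` stab0).

Definition irreducible_inclusion (N M : set (H -> H)) : Prop :=
  commutant N `&` M = scalar_operators.

End Operators.

(* Main.v *)
From HB Require Import structures.
From mathcomp Require Import ring lra zify.
Require Import Defs.
Set Implicit Arguments. Unset Strict Implicit. Unset Printing Implicit Defensive.

(** Write [tau] for [thoma_char k], [p_q] for [thoma_cycle k q] (the value of
    [tau] on cycles of length [q]) and [c] for [p_2].

    The transpositions [(0 n)] converge weakly, as [n] grows, to an operator [A]
    of [M] ([okounkov_operator]).  A permutation fixing [0] commutes with
    [(0 n)] for all large [n], so [A] also commutes with [N].  Irreducibility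
    therefore makes [A] a scalar, and evaluating [A] against [xi] and against
    [pi (0 1) xi] gives [p_3 = p_2 ^ 2] ([irreducible_cycle3]).  Consider the
    probability measure with mass [alpha i] at each point [alpha i], mass
    [beta i] at each point [- beta i], and mass [gamma] at [0]: its mean is
    [p_2], its second moment is [p_3].  The equality says that its variance is
    zero, so it is a point mass: at [1 / n] with [n] equal [alpha]s, at
    [- 1 / n] with [n] equal [beta]s, or at [0] ([cycle3_homogeneous]).

    Conversely, in these three cases [p_q = c ^ (q - 1)], that is [tau s] is [c]
    to the least number of transpositions with product [s].  Two cycles meeting
    in a single point multiply to a cycle, hence [tau (s t) = tau s * tau t] as
    soon as the supports of [s] and [t] meet at most in [0]
    ([thoma_char_mul]).  Let [T] belong to [M] and commute with [N].  The vector
    [eta = T xi] is fixed by the unitary conjugation by any [h] fixing [0], so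
    [<eta, pi a xi> = <eta, pi (h a h^-1) xi>].  Approximate [eta] by a finite
    combination of vectors [pi g xi] and let [h] push the support of [a], apart
    from [0], away from the supports of all these [g]: by multiplicativity the
    right-hand side is close to [<eta, xi> tau (a^-1)]
    ([conj_invariant_rdot]).  Thus [eta] is a multiple of [xi]; as [xi] is
    cyclic for the right translations, which commute with [M], [T] is a scalar
    ([irreducible_of_mul]).

    Two facts about operators support this.  The smallest von Neumann algebra
    containing a self-adjoint set of bounded operators is its bicommutant
    ([smallest_von_neumann]), which needs the existence of adjoints, hence the
    Riesz representation theorem ([riesz]).  And right translations, given on
    the orbit of [xi], extend to the whole space because they preserve inner
    products ([isometry_extension]). *)

(** * Sequences and limits *)

Lemma natSinv_small (R : realType) (e : R) : 0 < e ->
  exists N, forall n, (N <= n)%N -> n.+1%:R^-1 < e.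
Proof.
move=> e0; have [N _ NP] := near_infty_natSinv_lt (PosNum e0).
by exists N => n Nn; exact: NP.
Qed.

Lemma le_small_eq0 (R : realType) (r K : R) : 0 <= r -> (forall e, 0 < e -> r <= K * e) -> r = 0.
Proof.
move=> r0 h; apply/eqP; rewrite eq_le r0 andbT leNgt; apply/negP => rp.
have e0 : 0 < r / (2 * (`|K| + 1)) by rewrite divr_gt0 // mulr_gt0 // ltr_wpDl.
have := h _ e0; apply/negP; rewrite -ltNge.
have K1 : 0 < `|K| + 1 by rewrite ltr_wpDl.
rewrite mulrA ltr_pdivrMr ?mulr_gt0 // mulrC ltr_pM2l //.
by have := ler_norm K; lra.
Qed.

Lemma cvg_eq (R : realType) (f g : nat -> R) (l m : R) N :
  (forall n, (N <= n)%N -> f n = g n) ->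
  f @ \oo --> l -> g @ \oo --> m -> l = m.
Proof.
move=> fg fl gm.
have gl : g @ \oo --> l.
  by move: fl; apply: cvg_trans; apply: near_eq_cvg; exists N => // n /=; exact: fg.
by rewrite -(cvg_lim _ gl) // (cvg_lim _ gm).
Qed.

(** In the matrix coefficients that follow, convergence always holds because the
    sequence is constant from some index on; this form passes to linear
    combinations without any estimate. *)
Definition evconst (V : Type) (f : nat -> V) :=
  exists l, exists N, forall n, (N <= n)%N -> f n = l.

Lemma evconst_comp V W (h : V -> W) f : evconst f -> evconst (fun n => h (f n)).
Proof. by move=> [l [N NP]]; exists (h l), N => n /NP ->. Qed.

Lemma evconst_comp2 U V W (h : U -> V -> W) f g : evconst f -> evconst g ->
  evconst (fun n => h (f n) (g n)).
Proof.
move=> [l [N NP]] [m [M MP]]; exists (h l m), (maxn N M) => n.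
by rewrite geq_max => /andP[/NP -> /MP ->].
Qed.

(** * Linear maps *)

(** Operators on [H] are plain functions with a proof of linearity, so the usual
    consequences are restated for them. *)
Section LinearFacts.
Variables (R : realType) (H : completeNormedModType R[i]) (T : H -> H).
Hypothesis Tl : linear T.
Lemma lin0 : T 0 = 0.
Proof. by have := Tl (-1) 0 0; rewrite scaler0 add0r scaleN1r addNr. Qed.
Lemma linZ a x : T (a *: x) = a *: T x.
Proof. by rewrite -[a *: x]addr0 Tl lin0 addr0. Qed.
Lemma linD x y : T (x + y) = T x + T y.
Proof. by rewrite -[x]scale1r Tl !scale1r. Qed.
Lemma linB x y : T (x - y) = T x - T y.
Proof. by rewrite linD -scaleN1r linZ scaleN1r. Qed.
Lemma lin_sum (J : Type) (s : seq J) (F : J -> H) :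
  T (\sum_(i <- s) F i) = \sum_(i <- s) T (F i).
Proof. by apply: (big_morph T linD lin0). Qed.
End LinearFacts.

(** * Hilbert spaces through their real inner product *)

Section Hilbert.
Variables (R : realType) (H : completeNormedModType R[i]).
Variable dot : {dot H for conjC}.
Hypothesis hd : hilbert_dot dot.
Implicit Types (x y z : H) (t : R) (a : R[i]).

(** The real parts of the inner product and of the norm: the topology of [H] is
    that of a real Hilbert space, so estimates, infima and limits can be taken
    in [R] and complex scalars return only through [rdotZconj] and
    [rdot_dot]. *)
Definition re_dot x y : R := complex.Re (dot x y).
Definition re_norm x : R := complex.Re `|x|.
Local Notation rdot := re_dot.
Local Notation rnorm := re_norm.

Lemma ReD (a b : R[i]) : complex.Re (a + b) = complex.Re a + complex.Re b.
Proof. by case: a; case: b. Qed.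
Lemma ReN (a : R[i]) : complex.Re (- a) = - complex.Re a.
Proof. by case: a. Qed.
Lemma ReZ t (a : R[i]) : complex.Re (t%:C%C * a) = t * complex.Re a.
Proof. by case: a => a b /=; rewrite mul0r subr0. Qed.

Lemma norm_reE x : `|x| = (rnorm x)%:C%C.
Proof. by rewrite /re_norm RRe_real // ger0_real. Qed.
Lemma rnorm_ge0 x : 0 <= rnorm x.
Proof. by rewrite -(@ler0c R) -norm_reE. Qed.
Lemma rnorm2 x : rnorm x ^+ 2 = rdot x x.
Proof.
by apply: complexI; rewrite /re_dot hd !norm_reE -!rmorphXn.
Qed.
Lemma dotC x y : dot x y = (dot y x)^*%C.
Proof. by rewrite hermC expr0 mul1r. Qed.
Lemma rdotC x y : rdot x y = rdot y x.
Proof. by rewrite /re_dot dotC; case: (dot y x). Qed.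
Lemma rdotDl x y z : rdot (x + y) z = rdot x z + rdot y z.
Proof. by rewrite /re_dot linearDl ReD. Qed.
Lemma rdotNl x y : rdot (- x) y = - rdot x y.
Proof. by rewrite /re_dot linearNl ReN. Qed.
Lemma rdotBl x y z : rdot (x - y) z = rdot x z - rdot y z.
Proof. by rewrite rdotDl rdotNl. Qed.
Lemma rdotZl t x y : rdot (t%:C%C *: x) y = t * rdot x y.
Proof. by rewrite /re_dot linearZl_LR /= ReZ. Qed.
Lemma rdotDr x y z : rdot x (y + z) = rdot x y + rdot x z.
Proof. by rewrite !(rdotC x) rdotDl. Qed.
Lemma rdotNr x y : rdot x (- y) = - rdot x y.
Proof. by rewrite !(rdotC x) rdotNl. Qed.
Lemma rdotBr x y z : rdot x (y - z) = rdot x y - rdot x z.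
Proof. by rewrite !(rdotC x) rdotBl. Qed.
Lemma rdotZr t x y : rdot x (t%:C%C *: y) = t * rdot x y.
Proof. by rewrite !(rdotC x) rdotZl. Qed.
(** The trace left on the real inner product by its complex structure. *)
Lemma rdotZconj a x y : rdot (a *: x) y = rdot x (a^*%C *: y).
Proof. by rewrite /re_dot linearZl_LR [dot x _]linearZr_LR /= conjCK. Qed.
Lemma rnormD x y : rnorm (x + y) <= rnorm x + rnorm y.
Proof.
have := ler_normD x y; rewrite !norm_reE -rmorphD (@lecR R) //.
Qed.
Lemma rnormN x : rnorm (- x) = rnorm x.
Proof. by rewrite /re_norm normrN. Qed.
Lemma rnormB x y : rnorm (x - y) = rnorm (y - x).
Proof. by rewrite /re_norm distrC. Qed.
Lemma rnorm_eq0 x : rnorm x = 0 -> x = 0.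
Proof. by move=> x0; apply/normr0_eq0; rewrite norm_reE x0. Qed.
Lemma rnorm0 : rnorm 0 = 0.
Proof. by rewrite /re_norm normr0. Qed.
Lemma rnormZ a x : rnorm (a *: x) = complex.Re `|a| * rnorm x.
Proof. by apply: complexI; rewrite -norm_reE normrZ norm_reE rmorphM /= RRe_real // ger0_real. Qed.
Lemma rnormZ_real t x : rnorm (t%:C%C *: x) = `|t| * rnorm x.
Proof. by rewrite rnormZ normc_def /= expr0n /= addr0 sqrtr_sqr. Qed.

Lemma cauchy_schwarz x y : `|rdot x y| <= rnorm x * rnorm y.
Proof.
have [y0|y0] := eqVneq (rnorm y) 0.
  by rewrite (rnorm_eq0 y0) rnorm0 mulr0 rdotC -(scale0r x) (rdotZl 0) mul0r normr0.
have yp : 0 < rnorm y by rewrite lt_neqAle eq_sym y0 rnorm_ge0.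
rewrite -(@ler_pXn2r _ 2) ?nnegrE ?mulr_ge0 ?rnorm_ge0 // real_normK ?num_real // exprMn.
set t := rdot x y / rnorm y ^+ 2.
have : 0 <= rnorm (x - t%:C%C *: y) ^+ 2 by rewrite sqr_ge0.
(* The choice of [t] makes [t *: y] the projection of [x] on the line of [y]. *)
have -> : rnorm (x - t%:C%C *: y) ^+ 2 = rnorm x ^+ 2 - rdot x y ^+ 2 / rnorm y ^+ 2.
  rewrite rnorm2 !(rdotBl, rdotBr, rdotZl, rdotZr) -!rnorm2 (rdotC y x) /t.
  by field.
by rewrite subr_ge0 ler_pdivrMr ?exprn_gt0.
Qed.

Lemma hilbert_complete (u : nat -> H) :
  (forall e : R, 0 < e -> exists N, forall m n, (N <= m)%N -> (N <= n)%N ->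
     rnorm (u m - u n) < e) ->
  exists z, forall e : R, 0 < e -> exists N, forall n, (N <= n)%N ->
     rnorm (u n - z) < e.
Proof.
move=> uc.
have real_pos (e : R[i]) : 0 < e -> exists2 t : R, 0 < t & e = t%:C%C.
  move=> e0; exists (complex.Re e); first by rewrite -(@ltcR R) RRe_real ?gtr0_real.
  by rewrite RRe_real ?gtr0_real.
have /cauchy_cvgP/cvg_ex[z zP] : cauchy (u @ \oo).
  apply/cauchy_ballP => e /real_pos[t t0 ->].
  have [N NP] := uc t t0.
  exists (u @` [set n | (N <= n)%N], u @` [set n | (N <= n)%N]) => /=.
    by split; exists N => // n /= Nn; exists n.
  move=> [_ _] /= [[m Nm <-] [n Nn <-]].
  by rewrite -ball_normE /= norm_reE (@ltcR R) NP.
exists z => e e0.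
have /cvgrPdist_lt/(_ (e%:C%C)) := zP.
rewrite (@ltcR R 0) => /(_ e0)[N _ NP]; exists N => n Nn.
by have := NP n Nn; rewrite norm_reE (@ltcR R) rnormB.
Qed.

Lemma bounded_operatorP (T : H -> H) : bounded_operator T <->
  linear T /\ exists2 C : R, 0 <= C & forall x, rnorm (T x) <= C * rnorm x.
Proof.
rewrite /bounded_operator; split=> -[Tl].
  pose L := GRing.isLinear.Build _ _ _ _ T Tl.
  pose F : {linear H -> H} := HB.pack T L.
  move=> /(@linear_bounded_continuous _ _ _ F) /linear_boundedP /pinfty_ex_gt0 [r r0 Bf].
  split=> //; exists (complex.Re r).
    by rewrite -(@lecR R) RRe_real ?ger0_real // ltW.
  move=> x; have := Bf x; rewrite /= !norm_reE -{1}(RRe_real (gtr0_real r0)).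
  by rewrite -rmorphM (@lecR R).
move=> [C C0 CT]; split=> //.
pose L := GRing.isLinear.Build _ _ _ _ T Tl.
pose F : {linear H -> H} := HB.pack T L.
apply/(@linear_bounded_continuous _ _ _ F)/linear_boundedP.
near=> r => x.
apply: (@le_trans _ _ (C%:C%C * `|x|)).
  by rewrite !norm_reE -rmorphM (@lecR R) CT.
by rewrite ler_wpM2r //; near: r; apply: nbhs_pinfty_ge; rewrite ger0_real // (@lecR R 0).
Unshelve. all: by end_near. Qed.

Lemma denseP (D : set H) : dense D -> forall x (e : R), 0 < e ->
  exists2 y, D y & rnorm (x - y) < e.
Proof.
move=> dD x e e0.
have ec : 0 < e%:C%C by rewrite (@ltcR R 0).
have [y [By Dy]] : (ball x (e%:C%C) `&` D) !=set0.
  apply: dD; last exact: ball_open.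
  by exists x; exact: ballxx.
by exists y => //; move: By; rewrite -ball_normE /= norm_reE (@ltcR R).
Qed.

(** Riesz representation by minimisation: [J x = |x|^2 - 2 f x] is bounded below
    because [f] is bounded, the parallelogram identity makes minimising sequences
    Cauchy, and at the minimum the derivative [2 (<v, z> - f v)] of [J] in each
    direction [v] vanishes. *)
Lemma riesz (f : H -> R) (C : R) :
  (forall x y, f (x + y) = f x + f y) -> (forall t x, f (t%:C%C *: x) = t * f x) ->
  (forall x, `|f x| <= C * rnorm x) -> exists z, forall x, f x = rdot x z.
Proof.
move=> fD fZ fC.
pose J x := rdot x x - 2 * f x.
have Jlb x : - C ^+ 2 <= J x.
  rewrite /J -rnorm2.
  have := fC x; rewrite ler_norml => /andP[_ fx].
  have := sqr_ge0 (rnorm x - C); nra.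
have hJ : has_inf (range J).
  by split; [exists (J 0), 0|exists (- C ^+ 2) => _ [x _ <-]; exact: Jlb].
set m := inf (range J).
have mJ x : m <= J x by apply: ge_inf; [exact: hJ.2|exists x].
have /choice[u uP] : forall n, exists x, J x < m + n.+1%:R^-1.
  move=> n; have n0 : (0 : R) < n.+1%:R^-1 by rewrite invr_gt0.
  by have [_ [x _ <-] xP] := inf_adherent n0 hJ; exists x.
have Jexp t x v : J (x + t%:C%C *: v) = J x + 2 * t * (rdot v x - f v) + t ^+ 2 * rdot v v.
  rewrite /J fD fZ !(rdotDl, rdotDr, rdotZl, rdotZr) (rdotC x v); ring.
have par x y : rdot (x - y) (x - y) = 2 * J x + 2 * J y - 4 * J ((2^-1)%:C%C *: (x + y)).
  rewrite /J fZ fD !(rdotDl, rdotDr, rdotZl, rdotZr, rdotBl, rdotBr, rdotNl, rdotNr) (rdotC y x).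
  by field.
have uC i j : rnorm (u i - u j) ^+ 2 <= 2 * i.+1%:R^-1 + 2 * j.+1%:R^-1.
  rewrite rnorm2 par; have := mJ ((2^-1)%:C%C *: (u i + u j)).
  have := uP i; have := uP j.
  move: (J _) (J _) (J _) (m) (i.+1%:R^-1) (j.+1%:R^-1) => ? ? ? ? ? ?; lra.
have [z zP] : exists z, forall e : R, 0 < e -> exists N, forall n, (N <= n)%N ->
     rnorm (u n - z) < e.
  apply: hilbert_complete => // e e0.
  have [N NP] : exists N, forall n, (N <= n)%N -> n.+1%:R^-1 < e ^+ 2 / 4.
    by apply: natSinv_small; rewrite divr_gt0 ?exprn_gt0.
  exists N => i j /NP Ni /NP Nj; have := uC i j => uij.
  rewrite -(@ltr_pXn2r _ 2) ?nnegrE ?rnorm_ge0 ?(ltW e0) //.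
  by move: uij Ni Nj; move: (i.+1%:R^-1) (j.+1%:R^-1) => ? ?; lra.
exists z => v.
(* [J (z + t v) - J z >= 0], obtained as a limit along the minimising sequence. *)
have key t : 0 <= 2 * t * (rdot v z - f v) + t ^+ 2 * rdot v v.
  rewrite leNgt; apply/negP => X0.
  set X := (X in X < 0) in X0.
  pose K := `|2 * t| * rnorm v.
  have K0 : 0 <= K by rewrite mulr_ge0 ?rnorm_ge0.
  have [N1 N1P] := @natSinv_small R (- X / 2) ltac:(lra).
  have [|N2 N2P] := zP (- X / 2 / (K + 1)).
    by rewrite divr_gt0 //; lra.
  set n := maxn N1 N2.
  have := N1P n (leq_maxl _ _); have := N2P n (leq_maxr _ _).
  rewrite ltr_pdivlMr; last lra.
  move=> h1 h2.
  have := mJ (u n + t%:C%C *: v); rewrite Jexp => h3.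
  have h4 := uP n.
  have h5 : 2 * t * (rdot v (u n) - rdot v z) <= K * rnorm (u n - z).
    rewrite -rdotBr -mulrA -/K; apply: (le_trans (ler_norm _)).
    rewrite mulrA normrM /K -mulrA ler_wpM2l //; exact: cauchy_schwarz.
  have h6 : 0 <= rnorm (u n - z) by rewrite rnorm_ge0.
  have : K * rnorm (u n - z) < - X / 2.
    by apply: le_lt_trans h1; rewrite mulrC ler_wpM2l // lerDl.
  move: h2 h3 h4 h5; rewrite /X mulrBr.
  move: (n.+1%:R^-1) (J _) (t ^+ 2 * _) => ? ? ?; lra.
have B0 : 0 <= rdot v v by rewrite -rnorm2 sqr_ge0.
set d := rdot v z - f v in key.
set B := rdot v v in key B0.
suff : d = 0 by rewrite /d; lra.
(* The minimum over [t] is at [- d / B]; the shift by 1 allows [B = 0]. *)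
have := key (- d / (B + 1)).
have -> : 2 * (- d / (B + 1)) * d + (- d / (B + 1)) ^+ 2 * B = - (d ^+ 2 * (B + 2) / (B + 1) ^+ 2).
  by field; lra.
rewrite oppr_ge0 pmulr_lle0 ?invr_gt0 ?exprn_gt0; [|lra|lra].
rewrite pmulr_lle0; last lra.
by move=> h; apply/eqP; rewrite -sqrf_eq0 eq_le h sqr_ge0.
Qed.

Lemma rdot_inj y z : (forall x, rdot x y = rdot x z) -> y = z.
Proof.
move=> e; apply/eqP; rewrite -subr_eq0; apply/eqP/rnorm_eq0/eqP.
by rewrite -sqrf_eq0 rnorm2 rdotBr e subrr.
Qed.

(** A bounded real form [b] is the real part of [<y, A x>] for a complex linear
    [A] exactly when moving a scalar from [x] to [y] conjugates it. *)
Lemma form_operator (b : H -> H -> R) (C : R) :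
  (forall x y y', b x (y + y') = b x y + b x y') ->
  (forall t x y, b x (t%:C%C *: y) = t * b x y) ->
  (forall a x x' y, b (a *: x + x') y = b x (a^*%C *: y) + b x' y) ->
  (forall x y, `|b x y| <= C * rnorm x * rnorm y) ->
  exists2 A : H -> H, bounded_operator A & forall x y, rdot y (A x) = b x y.
Proof.
move=> bD bZ bl bC.
have /choice[A AP] : forall x, exists z, forall y, b x y = rdot y z.
  by move=> x; apply: (riesz (C := C * rnorm x)).
exists A => //; apply/bounded_operatorP; split.
  move=> a x x'; apply: rdot_inj => y.
  by rewrite -AP bl rdotDr -[a]conjcK -rdotZconj -!AP conjcK.
exists `|C| => // x.
have [x0|x0] := eqVneq (rnorm (A x)) 0.
  by rewrite x0 mulr_ge0 ?rnorm_ge0.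
have xp : 0 < rnorm (A x) by rewrite lt_neqAle eq_sym x0 rnorm_ge0.
rewrite -(ler_pM2r xp) -expr2 rnorm2 -AP.
apply: le_trans (ler_norm _) _; apply: le_trans (bC _ _) _.
by rewrite !ler_wpM2r ?rnorm_ge0 // ler_norm.
Qed.

(** Multiplying the first vector by [i] exposes the imaginary part. *)
Lemma rdot_dot (x y x' y' : H) : rdot x y = rdot x' y' ->
  rdot ('i%C *: x) y = rdot ('i%C *: x') y' -> dot x y = dot x' y'.
Proof.
rewrite /re_dot !linearZl_LR /=; case: (dot x y) => a b; case: (dot x' y') => c d /=.
by rewrite !mul0r !mul1r !sub0r => -> /oppr_inj ->.
Qed.

Lemma adjointP (T : H -> H) : bounded_operator T ->
  exists2 S : H -> H, bounded_operator S & forall x y, dot (T x) y = dot x (S y).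
Proof.
move=> /bounded_operatorP[Tl [C C0 TC]].
have [S Sb SP] : exists2 S : H -> H, bounded_operator S & forall y x, rdot x (S y) = rdot (T x) y.
  apply: (form_operator (C := C)) => [x y y'|t x y|a x x' y|x y].
  - by rewrite (linD Tl) rdotDl.
  - by rewrite (linZ Tl) rdotZl.
  - by rewrite rdotDr (linZ Tl) rdotZconj conjcK.
  - by rewrite (le_trans (cauchy_schwarz _ _))// mulrAC ler_wpM2r ?rnorm_ge0.
exists S => // x y; apply: rdot_dot; first by rewrite SP.
by rewrite SP (linZ Tl).
Qed.

Lemma bounded_dense_eq (T1 T2 : H -> H) (D : set H) :
  bounded_operator T1 -> bounded_operator T2 -> dense D ->
  (forall x, D x -> T1 x = T2 x) -> T1 = T2.
Proof.
move=> /bounded_operatorP[l1 [C1 C10 b1]] /bounded_operatorP[l2 [C2 C20 b2]] dD e.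
apply/funext => x; apply/eqP; rewrite -subr_eq0; apply/eqP/rnorm_eq0.
apply: (@le_small_eq0 _ _ (C1 + C2)) => [|d d0]; first exact: rnorm_ge0.
have [y Dy xy] := denseP dD x d0.
have -> : T1 x - T2 x = T1 (x - y) - T2 (x - y).
  by rewrite (linB l1) (linB l2) (e y Dy) opprB addrA subrK.
apply: le_trans (rnormD _ _) _; rewrite rnormN mulrDl lerD //.
  by rewrite (le_trans (b1 _)) // ler_wpM2l // ltW.
by rewrite (le_trans (b2 _)) // ler_wpM2l // ltW.
Qed.

Lemma bounded_comp (S T : H -> H) :
  bounded_operator S -> bounded_operator T -> bounded_operator (S \o T).
Proof.
move=> [Sl Sc] [Tl Tc]; split; first by move=> a x y /=; rewrite Tl Sl.
by move=> x; apply: continuous_comp; [exact: Tc|exact: Sc].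
Qed.

Lemma bounded_scale a : bounded_operator (fun x : H => a *: x).
Proof.
apply/bounded_operatorP; split.
  by move=> b x y; rewrite scalerDr !scalerA mulrC.
exists (complex.Re `|a|) => [|x]; first by rewrite normc_def sqrtr_ge0.
by rewrite rnormZ.
Qed.

(** Weak operator limits of contractions: density and the uniform bound turn
    convergence of the matrix coefficients on [D] into convergence everywhere, and
    the limit form is represented by an operator. *)
Lemma weak_limit (T : nat -> H -> H) (D : set H) :
  (forall n, linear (T n)) -> (forall n x, rnorm (T n x) <= rnorm x) -> dense D ->
  (forall x y, D x -> D y -> evconst (fun n => rdot y (T n x))) ->
  exists2 A : H -> H, bounded_operator A &
    forall x y, (fun n => rdot y (T n x)) @ \oo --> rdot y (A x).
Proof.
move=> Tl Tb dD ev.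
have cv x y : cvgn (fun n => rdot y (T n x)).
  apply/cauchy_cvgP/cauchy_ballP => e e0.
  pose K := rnorm x + rnorm y + 1.
  have K0 : 0 < K by rewrite ltr_wpDl ?addr_ge0 ?rnorm_ge0.
  pose d := minr 1 (e / 2 / K).
  have d0 : 0 < d by rewrite lt_min ltr01 !divr_gt0.
  have d1 : d <= 1 by rewrite ge_min lexx.
  have dK : K * d <= e / 2.
    by rewrite mulrC -ler_pdivlMr // ge_min lexx orbT.
  have [x' Dx xx] := denseP dD x d0; have [y' Dy yy] := denseP dD y d0.
  have [l [N NP]] := ev _ _ Dx Dy.
  have est n : (N <= n)%N -> `|rdot y (T n x) - l| < e / 2.
    move=> /NP <-.
    have -> : rdot y (T n x) - rdot y' (T n x') =
        rdot (y - y') (T n x) + (rdot y (T n (x - x')) - rdot (y - y') (T n (x - x'))).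
      rewrite (linB (Tl n)) !(rdotBl, rdotBr); ring.
    apply: (@lt_le_trans _ _ (K * d)) => //.
    have r1 := cauchy_schwarz (y - y') (T n x).
    have r2 := cauchy_schwarz y (T n (x - x')).
    have r3 := cauchy_schwarz (y - y') (T n (x - x')).
    have s1 := Tb n x; have s2 := Tb n (x - x').
    have x0 := rnorm_ge0 x; have y0 := rnorm_ge0 y.
    have t0 := rnorm_ge0 (y - y').
    have u0 := rnorm_ge0 (T n x). have v0 := rnorm_ge0 (T n (x - x')).
    apply: le_lt_trans (ler_normD _ _) _.
    have q1 : `|rdot (y - y') (T n x)| <= d * rnorm x.
      by apply: le_trans r1 _; apply: ler_pM => //; exact: ltW.
    have q2 : `|rdot y (T n (x - x'))| <= rnorm y * d.
      by apply: le_trans r2 _; apply: ler_pM => //; apply: le_trans s2 _; exact: ltW.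
    have q3 : `|rdot (y - y') (T n (x - x'))| < d.
      apply: le_lt_trans r3 _; apply: (@le_lt_trans _ _ (1 * rnorm (x - x'))).
        by apply: ler_pM => //; apply: le_trans d1; exact: ltW.
      by rewrite mul1r.
    have := ler_normB (rdot y (T n (x - x'))) (rdot (y - y') (T n (x - x'))).
    by rewrite /K; nra.
  exists ((fun n => rdot y (T n x)) @` [set n | (N <= n)%N],
          (fun n => rdot y (T n x)) @` [set n | (N <= n)%N]) => /=.
    by split; exists N => // n /= Nn; exists n.
  move=> [_ _] /= [[m Nm <-] [n Nn <-]].
  rewrite -ball_normE /=.
  have := est _ Nm; have := est _ Nn; rewrite distrC => h1 h2.
  by have := ler_distD l (rdot y (T m x)) (rdot y (T n x)); lra.
pose b x y := limn (fun n => rdot y (T n x)).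
have bP x y : (fun n => rdot y (T n x)) @ \oo --> b x y by exact: cv.
have bU x y l : (fun n => rdot y (T n x)) @ \oo --> l -> b x y = l.
  by move=> h; exact: cvg_lim.
have [A Ab AP] : exists2 A : H -> H, bounded_operator A & forall x y, rdot y (A x) = b x y.
  apply: (@form_operator b 1).
  - move=> x y y'; apply: bU.
    under eq_fun do rewrite rdotDl.
    exact: cvgD.
  - move=> t x y; apply: bU.
    under eq_fun do rewrite rdotZl.
    exact: cvgMr.
  - move=> a x x' y; apply: bU.
    under eq_fun do rewrite Tl rdotDr -[a]conjcK -rdotZconj conjcK.
    exact: cvgD.
  - move=> x y; rewrite mul1r.
    apply: (@le_trans _ _ (rnorm y * rnorm x)); last by rewrite mulrC.
    have h : (fun n => `|rdot y (T n x)|) @ \oo --> `|b x y| by exact: cvg_norm.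
    rewrite -(cvg_lim _ h) //; apply: limr_le; first by apply/cvg_ex; exists `|b x y|.
    near=> n; apply: le_trans (cauchy_schwarz _ _) _.
    by rewrite ler_wpM2l ?rnorm_ge0.
by exists A => // x y; rewrite AP.
Unshelve. all: by end_near. Qed.

(** Coefficients and indices are kept in a list independent of the family [v], so
    that the same combination can be formed in two families and compared. *)
Definition lincomb (I : Type) (v : I -> H) (l : seq (R[i] * I)) : H :=
  \sum_(p <- l) p.1 *: v p.2.

Lemma lincomb_cat I (v : I -> H) l l' :
  lincomb v (l ++ l') = lincomb v l + lincomb v l'.
Proof. exact: big_cat. Qed.

Lemma lincombZ I (v : I -> H) a l :
  lincomb v [seq (a * p.1, p.2) | p <- l] = a *: lincomb v l.
Proof.
by rewrite /lincomb big_map scaler_sumr; apply: eq_bigr => p _; rewrite scalerA.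
Qed.

Lemma span_lincomb I (v : I -> H) x :
  linear_span (range v) x -> exists l, x = lincomb v l.
Proof.
move=> [m [c [u [uv ->]]]].
have /choice[g gP] : forall j, exists i, v i = u j.
  by move=> j; have [i _ <-] := uv j; exists i.
exists [seq (c j, g j) | j <- enum 'I_m].
by rewrite /lincomb big_map big_enum; apply: eq_bigr => j _; rewrite gP.
Qed.

Lemma lincomb_gram I (v w : I -> H) :
  (forall i j, dot (v i) (v j) = dot (w i) (w j)) ->
  forall l, rnorm (lincomb v l) = rnorm (lincomb w l).
Proof.
move=> vw l.
have h j k : dot (lincomb v k) (v j) = dot (lincomb w k) (w j).
  by rewrite !linear_sumlz; apply: eq_bigr => p _; rewrite !linearZl_LR /= vw.
have h' k k' : dot (lincomb v k) (lincomb v k') = dot (lincomb w k) (lincomb w k').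
  by rewrite !linear_sumr; apply: eq_bigr => p _; rewrite !linearZr_LR /= h.
have : rnorm (lincomb v l) ^+ 2 = rnorm (lincomb w l) ^+ 2.
  by rewrite !rnorm2 /re_dot h'.
by move/eqP; rewrite eqrXn2 ?rnorm_ge0 // => /eqP.
Qed.

(** Equal Gram matrices make [lincomb v l |-> lincomb w l] well defined and
    isometric on a dense subspace.  The extension [U] is characterised by
    [|U x - lincomb w l| <= |x - lincomb v l|] for all [l], a condition that gives
    at once its values on [v], its contractivity and its linearity. *)
Lemma isometry_extension I (v w : I -> H) :
  dense (linear_span (range v)) ->
  (forall i j, dot (v i) (v j) = dot (w i) (w j)) ->
  exists U : H -> H, [/\ bounded_operator U, forall i, U (v i) = w i &
    forall x y, dot (U x) (U y) = dot x y].
Proof.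
move=> dv /lincomb_gram vw.
have lcB l l' : exists l'', forall u : I -> H,
    lincomb u l - lincomb u l' = lincomb u l''.
  exists (l ++ [seq (-1 * p.1, p.2) | p <- l']) => u.
  by rewrite lincomb_cat lincombZ scaleN1r.
have vwB l l' : rnorm (lincomb w l - lincomb w l') = rnorm (lincomb v l - lincomb v l').
  by have [l'' E] := lcB l l'; rewrite !E vw.
have app x (e : R) : 0 < e -> exists l, rnorm (x - lincomb v l) < e.
  by move=> /(denseP dv x)[_ /span_lincomb[l ->] xl]; exists l.
have /choice[U UP] : forall x, exists z, forall l,
    rnorm (z - lincomb w l) <= rnorm (x - lincomb v l).
  move=> x.
  have /choice[l lP] : forall n, exists l, rnorm (x - lincomb v l) < n.+1%:R^-1.
    by move=> n; apply: app; rewrite invr_gt0.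
  have [e e0|z zP] := @hilbert_complete (fun n => lincomb w (l n)).
    have [|N NP] := @natSinv_small R (e / 2); first by rewrite divr_gt0.
    exists N => m n /NP hm /NP hn; rewrite vwB.
    have -> : lincomb v (l m) - lincomb v (l n) =
      (x - lincomb v (l n)) - (x - lincomb v (l m)) by rewrite opprB [RHS]addrC addrA subrK.
    apply: le_lt_trans (rnormD _ _) _; rewrite rnormN.
    have := lP m; have := lP n; move: hm hn.
    by move: (m.+1%:R^-1) (n.+1%:R^-1) => ? ?; lra.
  exists z => k; apply/ler_addgt0Pr => e e0.
  have e2 : 0 < e / 2 by rewrite divr_gt0.
  have [N NP] := natSinv_small e2; have [M MP] := zP _ e2.
  set n := maxn N M.
  have h1 := NP n (leq_maxl _ _); have h2 := MP n (leq_maxr _ _).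
  have -> : z - lincomb w k = (z - lincomb w (l n)) + (lincomb w (l n) - lincomb w k).
    by rewrite addrA subrK.
  apply: le_trans (rnormD _ _) _; rewrite vwB (rnormB z).
  have -> : lincomb v (l n) - lincomb v k = (x - lincomb v k) - (x - lincomb v (l n)).
    by rewrite opprB [RHS]addrC addrA subrK.
  have := rnormD (x - lincomb v k) (- (x - lincomb v (l n))); rewrite rnormN.
  have := lP n; move: h1 h2; move: (n.+1%:R^-1) => ?.
  by lra.
have Uv i : U (v i) = w i.
  have := UP (v i) [:: (1, i)].
  rewrite /lincomb !big_seq1 !scale1r subrr rnorm0 => h.
  apply/eqP; rewrite -subr_eq0; apply/eqP/rnorm_eq0/eqP.
  by rewrite eq_le h rnorm_ge0.
have Uext x : rnorm (U x) <= rnorm x.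
  by have := UP x [::]; rewrite /lincomb !big_nil !subr0.
have Ul : linear U.
  move=> a x y; apply/eqP; rewrite -subr_eq0; apply/eqP/rnorm_eq0.
  apply: (@le_small_eq0 _ _ (2 * (complex.Re `|a| + 1))) => [|e e0]; first exact: rnorm_ge0.
  have [l xl] := app x e e0; have [k yk] := app y e e0.
  pose m := [seq (a * p.1, p.2) | p <- l] ++ k.
  have mE (u : I -> H) : lincomb u m = a *: lincomb u l + lincomb u k.
    by rewrite lincomb_cat lincombZ.
  have -> : U (a *: x + y) - (a *: U x + U y) =
    (U (a *: x + y) - lincomb w m) - (a *: (U x - lincomb w l) + (U y - lincomb w k)).
    by rewrite mE scalerBr [X in _ = _ - X]addrACA -opprD opprB addrA subrK.
  apply: le_trans (rnormD _ _) _; rewrite rnormN.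
  have h1 := UP (a *: x + y) m.
  have h2 : rnorm (a *: x + y - lincomb v m) <= complex.Re `|a| * e + e.
    rewrite mE (_ : _ - _ = a *: (x - lincomb v l) + (y - lincomb v k)); last first.
      by rewrite scalerBr opprD addrACA.
    apply: le_trans (rnormD _ _) _; rewrite rnormZ lerD ?(ltW yk) //.
    by rewrite ler_wpM2l ?(ltW xl) // normc_def sqrtr_ge0.
  have h3 : rnorm (a *: (U x - lincomb w l) + (U y - lincomb w k)) <= complex.Re `|a| * e + e.
    apply: le_trans (rnormD _ _) _; rewrite rnormZ lerD //.
      rewrite ler_wpM2l //; first by rewrite normc_def sqrtr_ge0.
      by apply: le_trans (UP _ _) _; exact: ltW.
    by apply: le_trans (UP _ _) _; exact: ltW.
  lra.
have Uiso x : rnorm (U x) = rnorm x.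
  apply/eqP; rewrite eq_le Uext /=; apply/ler_addgt0Pr => e e0.
  have e2 : 0 < e / 2 by rewrite divr_gt0.
  have [l xl] := app x _ e2; have := UP x l.
  have := rnormD (x - lincomb v l) (lincomb v l); rewrite subrK vw.
  have := rnormD (U x) (lincomb w l - U x); rewrite addrC subrK (rnormB _ (U x)).
  by lra.
exists U; split=> //.
  by apply/bounded_operatorP; split=> //; exists 1 => // x; rewrite mul1r.
have polar x y : rdot x y = (rnorm (x + y) ^+ 2 - rnorm (x - y) ^+ 2) / 4.
  rewrite !rnorm2 !(rdotBl, rdotBr, rdotDl, rdotDr, rdotNl, rdotNr) (rdotC y x).
  by field.
have Ur x y : rdot (U x) (U y) = rdot x y.
  by rewrite !polar -linB // -linD // !Uiso.
by move=> x y; apply: rdot_dot => //; rewrite -linZ.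
Qed.

End Hilbert.

(** * Commutants *)

Section Commutants.
Variables (R : realType) (H : completeNormedModType R[i]).
Variable dot : {dot H for conjC}.
Hypothesis hd : hilbert_dot dot.
Implicit Types (A B : set (H -> H)) (T S : H -> H).

Lemma commutantS A B : A `<=` B -> commutant B `<=` commutant A.
Proof. by move=> AB T [Tb TB]; split=> // S /AB; exact: TB. Qed.

Lemma commutant2 A : (forall T, A T -> bounded_operator T) ->
  A `<=` commutant (commutant A).
Proof. by move=> Ab T AT; split=> [|S [_ /(_ T AT)]]; [exact: Ab|]. Qed.

Lemma commutant3 A : (forall T, A T -> bounded_operator T) ->
  commutant (commutant (commutant A)) = commutant A.
Proof.
move=> Ab; apply/seteqP; split; first exact/commutantS/commutant2.
by apply: commutant2 => T [].
Qed.

Lemma adjoint_closed_commutant A : (forall T, A T -> bounded_operator T) ->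
  adjoint_closed dot A -> adjoint_closed dot (commutant A).
Proof.
move=> Ab Aadj T [Tb TA]; have [S Sb SP] := adjointP hd Tb.
exists S => //; split=> // U /Aadj[V AV VP]; apply/funext => x /=.
apply: (rdot_inj hd) => y; rewrite /re_dot -SP.
have VT z : V (T z) = T (V z) by have /(congr1 (@^~ z)) := TA V AV.
have UP u v : dot u (U v) = dot (V u) v.
  by rewrite dotC VP -dotC.
by rewrite UP VT SP UP.
Qed.

Lemma von_neumann_commutant2 A : (forall T, A T -> bounded_operator T) ->
  adjoint_closed dot A -> von_neumann_algebra dot (commutant (commutant A)).
Proof.
move=> Ab Aadj; split; last by rewrite commutant3 // => T [].
apply: adjoint_closed_commutant; first by move=> T [].
exact: adjoint_closed_commutant.
Qed.

(** The bicommutant lies in every von Neumann algebra [B] containing [A], since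
    [B] is its own bicommutant; it is one itself because taking adjoints
    preserves commutants. *)
Lemma smallest_von_neumann A : (forall T, A T -> bounded_operator T) ->
  adjoint_closed dot A ->
  smallest (von_neumann_algebra dot) A = commutant (commutant A).
Proof.
move=> Ab Aadj; apply/seteqP; split=> T.
  by apply; split; [exact: von_neumann_commutant2|exact: commutant2].
by move=> AT B [[_ BE] AB]; rewrite -BE; apply: commutantS AT; exact: commutantS.
Qed.

Lemma scalar_commutant A : (forall T, A T -> bounded_operator T) ->
  scalar_operators (H := H) `<=` commutant A.
Proof.
move=> Ab _ [c ->]; split=> [|S /Ab[Sl _]]; first exact: bounded_scale.
by apply/funext => x /=; rewrite linZ.
Qed.

End Commutants.

Section Representation.
Variables (R : realType) (H : completeNormedModType R[i]).
Variable dot : {dot H for conjC}.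
Hypothesis hd : hilbert_dot dot.
Variable pi : finperm -> H -> H.
Hypothesis pr : unitary_rep dot pi.
Local Notation rnorm := (@re_norm R H).

Lemma rep_linear s : linear (pi s). Proof. by case: pr. Qed.
Lemma rep_dot s x y : dot (pi s x) (pi s y) = dot x y. Proof. by case: pr. Qed.
Lemma rep1 x : pi 1%g x = x. Proof. by case: pr => _ _ ->. Qed.
Lemma repM s t x : pi (s * t)%g x = pi s (pi t x).
Proof. by case: pr => _ _ _ ->. Qed.
Lemma rep_rnorm s x : rnorm (pi s x) = rnorm x.
Proof.
apply/eqP; rewrite -(@eqrXn2 _ 2) ?rnorm_ge0 //.
by rewrite !(rnorm2 hd) /re_dot rep_dot.
Qed.
Lemma rep_bounded s : bounded_operator (pi s).
Proof.
apply/bounded_operatorP; split; first exact: rep_linear.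
by exists 1 => // x; rewrite rep_rnorm mul1r.
Qed.
Lemma rep_adjoint s x y : dot (pi s x) y = dot x (pi s^-1%g y).
Proof. by rewrite -{1}(rep1 y) -(mulgV s) repM rep_dot. Qed.

Lemma rep_subgroup_commutant2 (G : set finperm) : (forall s, G s -> G s^-1%g) ->
  smallest (von_neumann_algebra dot) (pi @` G) = commutant (commutant (pi @` G)).
Proof.
move=> GV; apply: smallest_von_neumann => // [_ [s _ <-]|_ [s Gs <-]].
  exact: rep_bounded.
exists (pi s^-1%g); first by exists s^-1%g => //; exact: GV.
by move=> x y; rewrite rep_adjoint.
Qed.

(** The relative commutant of [N] only involves the generators of [N], and always
    contains the scalars. *)
Lemma irreducibleP : irreducible_inclusion (N_alg dot pi) (M_alg pi) <->
  forall T, commutant (pi @` stab0) T -> M_alg pi T -> scalar_operators T.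
Proof.
have pb (G : set finperm) T : (pi @` G) T -> bounded_operator T.
  by move=> [s _ <-]; exact: rep_bounded.
rewrite /irreducible_inclusion /N_alg rep_subgroup_commutant2; last first.
  by move=> s s0; rewrite /stab0 /= -{1}s0 -finpermME mulVg.
rewrite commutant3; last exact: pb.
split=> [e T TN TM|h]; first by rewrite -e.
apply/seteqP; split=> [T [TN TM]|T Ts]; first exact: h.
split; apply: scalar_commutant Ts => S; first exact: pb.
by case.
Qed.
End Representation.

(** * Finite permutations *)

(* Keeps simplification from unfolding the values of products and
   transpositions. *)
Arguments finperm_fun : simpl never.

Lemma finpermK (s : finperm) : cancel s (s^-1)%g.
Proof. by move=> n; rewrite -finpermME mulVg. Qed.
Lemma finpermVK (s : finperm) : cancel (s^-1)%g s.
Proof. by move=> n; rewrite -finpermME mulgV. Qed.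
Lemma finperm_inj (s : finperm) : injective s.
Proof. exact: can_inj (finpermK s). Qed.

Lemma finperm_bounded (s : finperm) : exists N, forall n, (N <= n)%N -> s n = n.
Proof.
have /finite_seqP[l lP] := finperm_supp s.
exists (\max_(i <- l) i).+1 => n ln; apply/eqP/negPn/negP => sn.
have : n \in l by have : [set n | s n != n] n := sn; rewrite lP.
by move=> nl; have := @leq_bigmax_seq _ l predT id n nl isT; rewrite leqNgt ln.
Qed.

Lemma involution_finite N (f : nat -> nat) : (forall n, (N <= n)%N -> f n = n) ->
  finite_set [set n | f n != n].
Proof.
move=> fN; apply: (@sub_finite_set _ _ `I_N); last exact: finite_II.
by move=> n /= fn; rewrite ltnNge; apply: contra fn => /fN ->.
Qed.

Definition mk_involution N (f : nat -> nat) (ff : involutive f)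
  (fN : forall n, (N <= n)%N -> f n = n) : finperm :=
  FinPerm (inv_bij ff) (involution_finite fN).

Definition swap_fun (m n x : nat) := if x == m then n else if x == n then m else x.
Lemma swap_funK m n : involutive (swap_fun m n).
Proof.
move=> x; rewrite /swap_fun; case: (eqVneq x m) => [->|xm].
  by case: eqVneq => [//|_]; rewrite eqxx.
by case: (eqVneq x n) => [->|xn]; rewrite ?eqxx // (negPf xm) (negPf xn).
Qed.
Lemma swap_fun_bound m n x : (maxn m n < x)%N -> swap_fun m n x = x.
Proof. by rewrite gtn_max /swap_fun => /andP[mx nx]; rewrite !gtn_eqF. Qed.
Definition swap m n : finperm := mk_involution (@swap_funK m n) (@swap_fun_bound m n).

Lemma swapL m n : swap m n m = n.
Proof. by rewrite /finperm_fun /= /swap_fun eqxx. Qed.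
Lemma swapR m n : swap m n n = m.
Proof. by rewrite /finperm_fun /= /swap_fun eqxx; case: eqVneq. Qed.
Lemma swapD m n x : x != m -> x != n -> swap m n x = x.
Proof. by rewrite /finperm_fun /= /swap_fun => /negPf -> /negPf ->. Qed.
Lemma swap_mul m n : (swap m n * swap m n = 1)%g.
Proof. by apply: finpermP => x; exact: swap_funK. Qed.
Lemma swapV m n : ((swap m n)^-1 = swap m n)%g.
Proof. by apply: (@mulgI _ (swap m n)); rewrite mulgV swap_mul. Qed.

Lemma swap_commute m n (s : finperm) : s m = m -> s n = n -> (swap m n * s = s * swap m n)%g.
Proof.
move=> sm sn; apply: finperm_disjC => x.
have [->|xm] := eqVneq x m; first by right.
have [->|xn] := eqVneq x n; first by right.
by left; exact: swapD.
Qed.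

Lemma swap_conj m n : m != 0%N -> n != 0%N ->
  (swap m n * swap 0 m * (swap m n)^-1 = swap 0 n)%g.
Proof.
move=> m0 n0; rewrite swapV.
have [->|mn] := eqVneq m n.
  have snn x : swap n n x = x.
    by rewrite /finperm_fun /= /swap_fun; case: eqVneq.
  by apply: finpermP => x; rewrite !finpermME !snn.
apply: finpermP => x; rewrite !finpermME.
have [->|x0] := eqVneq x 0%N.
  by rewrite (@swapD m n 0) 1?eq_sym // !swapL.
have [->|xn] := eqVneq x n; first by rewrite !swapR swapD // eq_sym.
rewrite [RHS]swapD //.
have [->|xm] := eqVneq x m.
  by rewrite swapL (@swapD 0 m n) ?swapR // eq_sym.
by rewrite (swapD xm xn) (swapD x0 xm) swapD.
Qed.

(** An [h] fixing [0] that carries the rest of any bounded set beyond any given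
    bound: it exchanges the interval from [1] to [K - 1] with a far translate. *)
Lemma exists_shift K N : exists2 h : finperm, h 0%N = 0%N &
  forall n, (0 < n < K)%N -> (N <= h n)%N.
Proof.
pose M := (K + N)%N.
pose f x := if (0 < x < K)%N then (x + M)%N
  else if (M < x < M + K)%N then (x - M)%N else x.
have ff : involutive f by rewrite /f /M => x; do ?case: ifP; lia.
have fN n : (M + K <= n)%N -> f n = n by rewrite /f /M => h; do ?case: ifP; lia.
exists (mk_involution ff fN) => // n nK.
by rewrite /finperm_fun /= /f nK /M; lia.
Qed.

Section Char.
Variables (R : realType) (k : thoma_param R).
Local Notation tau := (thoma_char k).

Lemma iter_conj (g h : finperm) j n :
  iter j (h * g * h^-1)%g n = h (iter j g ((h^-1)%g n)).
Proof.
elim: j => [|j IH]; first by rewrite /= finpermVK.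
by rewrite !iterS IH !finpermME finpermK.
Qed.

Lemma finite_orbit (g : finperm) n : g n != n -> finite_set [set iter j g n | j in [set: nat]].
Proof.
move=> gn; apply: sub_finite_set (finperm_supp g) => _ [j _ <-].
exact: finperm_iter_moved.
Qed.

Lemma cycle_supports_conj (g h : finperm) :
  cycle_supports (h * g * h^-1)%g = (fun O => h @` O) @` cycle_supports g.
Proof.
apply/seteqP; split=> [_ [n /= hn <-]|_ [_ [n /= gn <-] <-]].
  exists [set iter j g ((h^-1)%g n) | j in setT].
    exists ((h^-1)%g n) => //=.
    by apply: contra_neq hn => gn; rewrite !finpermME gn finpermVK.
  by rewrite image_comp; apply: eq_imagel => j _ /=; rewrite iter_conj.
exists (h n) => /=.
  apply: contra_neq gn; rewrite !finpermME finpermK.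
  exact: finperm_inj.
by rewrite image_comp; apply: eq_imagel => j _ /=; rewrite iter_conj finpermK.
Qed.

Lemma thoma_char_conj g h : tau (h * g * h^-1)%g = tau g.
Proof.
rewrite /thoma_char cycle_supports_conj fsbig_image; last first.
  have hK X : (h^-1)%g @` (h @` X) = X.
    rewrite image_comp -[RHS]image_id.
    by apply: eq_imagel => n _; exact: finpermK.
  by move=> A B _ _ AB; rewrite -(hK A) AB hK.
apply: eq_fsbigr => O; rewrite inE => -[n /= gn <-].
rewrite fset_set_image; last exact: finite_orbit.
by rewrite card_imfset //; exact: finperm_inj.
Qed.

Lemma thoma_char_swap n : n != 0%N -> tau (swap 0 n) = thoma_cycle k 2.
Proof.
move=> n0; rewrite (@thoma_char_cycle _ _ _ [:: 0%N; n]) //.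
- by rewrite /= inE eq_sym n0.
- by rewrite /= swapL swapR !eqxx.
- by move=> x; rewrite !inE negb_or => /andP[? ?]; exact: swapD.
Qed.

(** The product of two transpositions sharing [0] is a 3-cycle; this is where the
    third power sum enters. *)
Lemma thoma_char_swap2 m n : m != 0%N -> n != 0%N -> m != n ->
  tau (swap 0 m * swap 0 n)%g = thoma_cycle k 3.
Proof.
move=> m0 n0 mn; rewrite (@thoma_char_cycle _ _ _ [:: 0%N; n; m]) //.
- by rewrite /= !inE negb_or eq_sym n0 eq_sym m0 eq_sym mn.
- rewrite /= andbT !finpermME swapL swapR swapL [swap 0 n m]swapD // swapR.
  by rewrite swapD ?eqxx // eq_sym.
- by move=> x; rewrite !inE !negb_or finpermME => /and3P[? ? ?]; rewrite !swapD.
Qed.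

End Char.

Section Restrict.
Variables (s : finperm) (P : pred nat).
Hypothesis sP : forall n, P (s n) = P n.

Lemma stableV n : P ((s^-1)%g n) = P n.
Proof. by rewrite -sP finpermVK. Qed.

(** Restricting a permutation to an invariant set of points splits off one of its
    cycles. *)
Definition frestr_fun n := if P n then s n else n.

Fact frestr_bij : bijective frestr_fun.
Proof.
exists (fun n => if P n then (s^-1)%g n else n) => n; rewrite /frestr_fun.
  by have [Pn|/negPf Pn] := boolP (P n); rewrite ?sP Pn ?finpermK.
by have [Pn|/negPf Pn] := boolP (P n); rewrite ?stableV Pn ?finpermVK.
Qed.

Fact frestr_supp : finite_set [set n | frestr_fun n != n].
Proof.
apply: sub_finite_set (finperm_supp s) => n /=; rewrite /frestr_fun.
by case: ifP => //; rewrite eqxx.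
Qed.

Definition frestr : finperm := FinPerm frestr_bij frestr_supp.

Lemma frestr_in n : P n -> frestr n = s n.
Proof. by rewrite /finperm_fun /= /frestr_fun => ->. Qed.
Lemma frestr_out n : ~~ P n -> frestr n = n.
Proof. by rewrite /finperm_fun /= /frestr_fun => /negPf ->. Qed.
End Restrict.

Lemma eq_fpath (f g : nat -> nat) x p :
  {in belast x p, f =1 g} -> fpath f x p = fpath g x p.
Proof.
elim: p x => //= y p IH x h; rewrite (h x) ?mem_head // IH // => z zp.
by apply: h; rewrite inE zp orbT.
Qed.

(** The orbit of a moved point as an explicit cycle.  Its first two entries are
    displayed so that a new point can be inserted between them. *)
Lemma exists_cycle (s : finperm) n : s n != n -> exists p,
  [/\ uniq (n :: s n :: p), fcycle s (n :: s n :: p),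
      forall m, m \in n :: s n :: p -> s m != m &
      forall m, (s m \in n :: s n :: p) = (m \in n :: s n :: p)].
Proof.
move=> sn.
have /finite_seqP[l lP] := finperm_supp s.
have ol i : iter i s n \in l.
  have : [set n | s n != n] (iter i s n) by exact: finperm_iter_moved.
  by rewrite lP.
have iterI i j : iter i s n = iter (i + j) s n -> iter j s n = n.
  elim: i => // i IH; rewrite addSn !iterS => /finperm_inj; exact: IH.
have exq : exists q, (0 < q)%N && (iter q s n == n).
  have : ~~ uniq (traject s n (size l).+1).
    apply/negP => u; have := uniq_leq_size u; rewrite size_traject.
    move=> /(_ l) h; suff : (size l < size l)%N by rewrite ltnn.
    by apply: h => x /trajectP[i _ ->].
  move=> /(uniqPn n)[i [j [ij]]]; rewrite size_traject => jl.
  rewrite !nth_traject //; last exact: ltn_trans jl.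
  rewrite -(subnKC (ltnW ij)) => /iterI/eqP e.
  by exists (j - i)%N; rewrite subn_gt0 ij.
case: (ex_minnP exq) => q /andP[q0 /eqP qn] qmin.
have q1 : (1 < q)%N.
  by case: q q0 qn {qmin} => [|[|q]] //= _ e; rewrite e eqxx in sn.
have cE : traject s n q = n :: s n :: traject s (s (s n)) q.-2.
  by case: q q1 {q0 qn qmin} => [|[|q]].
have cc : fcycle s (traject s n q).
  rewrite -(prednK q0) /= rcons_path fpath_traject last_traject /=.
  by apply/eqP; rewrite -iterS prednK.
exists (traject s (s (s n)) q.-2); rewrite -cE; split=> //.
  apply/negPn/negP => /(uniqPn n)[i [j [ij]]]; rewrite size_traject => jq.
  rewrite !nth_traject //; last exact: ltn_trans jq.
  rewrite -(subnKC (ltnW ij)) => /iterI/eqP e.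
  have := qmin (j - i)%N; rewrite subn_gt0 ij e => /(_ isT); lia.
  by move=> m /trajectP[i _ ->]; exact: finperm_iter_moved.
move=> m; apply/idP/idP => [mc|mc].
  have /eqP/finperm_inj <- := prev_cycle cc mc.
  by rewrite mem_prev.
by rewrite (eqP (next_cycle cc mc)) mem_next.
Qed.

(** The hypothesis says that [p_q = p_2 ^ (q - 1)] for [q >= 2], i.e. that each
    new point of a cycle contributes the factor [p_2]. *)
Section Geometric.
Variables (R : realType) (k : thoma_param R).
Local Notation tau := (thoma_char k).
Hypothesis geom : forall q, (1 < q)%N ->
  thoma_cycle k q.+1 = thoma_cycle k 2 * thoma_cycle k q.

(** If [s] moves [0], multiplying by [(0 m)] inserts the fixed point [m] right
    after [0] in the cycle of [0] and leaves the other cycles alone. *)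
Lemma thoma_char_mul_swap (s : finperm) m : m != 0%N -> s m = m ->
  tau (s * swap 0 m)%g = tau s * thoma_cycle k 2.
Proof.
move=> m0 sm.
have [s0|s0] := eqVneq (s 0%N) 0%N.
  rewrite thoma_charM ?thoma_char_swap // => n.
  have [->|n0] := eqVneq n 0%N; first by left.
  have [->|nm] := eqVneq n m; first by left.
  by right; exact: swapD.
have [p [uc cc cm sc]] := exists_cycle s0.
set c := 0%N :: _ in uc cc cm sc.
have sc' n : (s n \notin c) = (n \notin c) by rewrite sc.
pose s1 := frestr sc; pose s2 := frestr sc'.
have s1in n : n \in c -> s1 n = s n by exact: frestr_in.
have s1out n : n \notin c -> s1 n = n by exact: frestr_out.
have s2in n : n \in c -> s2 n = n by move=> nc; apply: frestr_out; rewrite negbK.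
have s2out n : n \notin c -> s2 n = s n by exact: frestr_in.
have d12 n : s1 n = n \/ s2 n = n.
  by case: (boolP (n \in c)) => nc; [right; exact: s2in|left; exact: s1out].
have sE : s = (s1 * s2)%g.
  apply: finpermP => n; rewrite finpermME.
  case: (boolP (n \in c)) => nc; first by rewrite s2in // s1in.
  by rewrite s2out // s1out // sc.
have c0 : 0%N \in c by rewrite mem_head.
have mc : m \notin c.
  by apply/negP => /cm; rewrite sm eqxx.
have wE : (s * swap 0 m = s2 * (s1 * swap 0 m))%g.
  by rewrite {1}sE (finperm_disjC d12) mulgA.
have dw n : s2 n = n \/ (s1 * swap 0 m)%g n = n.
  case: (boolP (n \in c)) => nc; first by left; exact: s2in.
  have [->|nm] := eqVneq n m; first by left; rewrite s2out.
  right; rewrite finpermME swapD ?s1out //.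
  by apply: contraNneq nc => ->.
have -> : tau s = tau s1 * tau s2 by rewrite {1}sE (thoma_charM k d12).
rewrite wE (thoma_charM k dw).
have c1 : fcycle s1 c.
  rewrite -[cycle _ _]/(fpath s1 0%N (rcons (s 0%N :: p) 0%N)).
  rewrite -(@eq_fpath s s1) // belast_rcons => n nc.
  by rewrite s1in.
rewrite (thoma_char_cycle k uc _ c1) //.
have sp : s 0%N :: p = behead c by [].
have inc n : n \in s 0%N :: p -> n \in c by move=> h; rewrite inE h orbT.
rewrite (@thoma_char_cycle _ _ (s1 * swap 0 m)%g (0%N :: m :: s 0%N :: p)) //.
- by rewrite /= geom //; ring.
- have /andP[h1 h2] : (0%N \notin s 0%N :: p) && uniq (s 0%N :: p) by exact: uc.
  move: mc; rewrite in_cons negb_or => /andP[_ h3].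
  by rewrite cons_uniq (cons_uniq m) in_cons negb_or eq_sym m0 h1 h3 h2.
- rewrite /= !finpermME swapL s1out // swapR s1in // !eqxx /=.
  move: cc => /= /andP[_ cc].
  rewrite (@eq_fpath _ s) // belast_rcons => n nc.
  rewrite finpermME swapD; first by rewrite s1in // inc.
  + by move: uc; rewrite cons_uniq => /andP[h _]; apply: contraNneq h => e; rewrite -{1}e.
  + by apply: contraNneq mc => <-; exact: inc.
- move=> n; rewrite in_cons negb_or in_cons negb_or => /and3P[n0 nm nc].
  have nc' : n \notin c by rewrite /c in_cons negb_or n0.
  by rewrite finpermME swapD // s1out.
Qed.

(** Transpositions [(0 m)] with [m = t 0] are peeled off [t] until [0] is fixed:
    each removes the point [m] from the support of [t], and [m] is fixed by
    [s].  When [t] fixes [0] the supports are disjoint. *)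
Lemma thoma_char_mul (s t : finperm) :
  (forall n, n != 0%N -> s n = n \/ t n = n) -> tau (s * t)%g = tau s * tau t.
Proof.
have /finite_seqP[l lP] := finperm_supp t.
have {lP} : forall n, t n != n -> n \in l.
  by move=> n tn; have : [set n | t n != n] n := tn; rewrite lP.
elim: {l}_.+1 {-2}l (ltnSn (size l)) t => // N IH l lN t tl st.
have [t0|t0] := eqVneq (t 0%N) 0%N.
  apply: thoma_charM => n; have [->|n0] := eqVneq n 0%N; first by right.
  exact: st.
set m := t 0%N in t0.
have tm : t m != m by rewrite /m; exact: (finperm_iter_moved 1).
have sm : s m = m by case: (st m t0) => // e; rewrite e eqxx in tm.
pose t' : finperm := (t * swap 0 m)%g.
have tE : t = (t' * swap 0 m)%g by rewrite /t' -mulgA swap_mul mulg1.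
have t'm : t' m = m by rewrite finpermME swapR.
have t'D n : n != 0%N -> n != m -> t' n = t n by move=> ? ?; rewrite finpermME swapD.
have t'l n : t' n != n -> n \in [seq x <- l | x != m].
  move=> h; rewrite mem_filter /=.
  have nm : n != m by apply: contraNneq h => ->; rewrite t'm.
  rewrite nm /=; apply: tl; have [->//|n0] := eqVneq n 0%N.
  by rewrite -t'D.
have lt : (size ([seq x <- l | x != m]) < N)%N.
  apply: leq_trans (_ : size l <= N)%N; last exact: lN.
  rewrite size_filter -(count_predC (fun x => x != m)) -addn1 leq_add2l -has_count.
  by apply/hasP; exists m; [exact: tl|rewrite /= negbK].
have st' n : n != 0%N -> s n = n \/ t' n = n.
  move=> n0; have [->|nm] := eqVneq n m; first by left.
  by rewrite t'D //; exact: st.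
have st'm : (s * t')%g m = m by rewrite finpermME t'm.
rewrite tE mulgA (thoma_char_mul_swap t0 st'm) (thoma_char_mul_swap t0 t'm).
by rewrite (IH _ lt t' t'l st') mulrA.
Qed.
End Geometric.

(** * Thoma parameters *)

Section Sums.
Variable R : realType.
Implicit Types (f g u : nat -> R) (l c : R).

Lemma ge0_series_term_le f l : (forall i, 0 <= f i) -> series f @ \oo --> l ->
  forall i, f i <= l.
Proof.
move=> f0 fl i; have h : series f i.+1 <= l.
  rewrite -(cvg_lim _ fl) //; apply: nondecreasing_cvgn_le.
    by apply: nondecreasing_series => j _ _; exact: f0.
  by apply/cvg_ex; exists l.
by apply: le_trans h; rewrite /series /= big_nat_recr //= lerDr sumr_ge0.
Qed.

Lemma ge0_series_eq0 f l : (forall i, 0 <= f i) -> series f @ \oo --> l -> l <= 0 ->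
  forall i, f i = 0.
Proof.
move=> f0 fl l0 i; apply/eqP; rewrite eq_le f0 andbT.
by apply: le_trans l0; exact: ge0_series_term_le.
Qed.

Lemma series_step f n c : (forall i, f i = if (i < n)%N then c else 0) ->
  series f @ \oo --> c *+ n.
Proof.
move=> fE; apply: cvg_near_cst; exists n => // m /= nm.
rewrite /series /= (big_cat_nat (leq0n n) nm) /= [X in _ + X]big1_seq ?addr0; last first.
  by move=> i /andP[_]; rewrite mem_index_iota fE => /andP[ni _]; rewrite ltnNge ni.
rewrite big_nat (eq_bigr (fun=> c)) -?big_nat ?sumr_const_nat ?subn0 // => i /= ni.
by rewrite fE ni.
Qed.

(** The terms of a convergent series tend to zero, so only finitely many of them
    equal [c]; monotonicity puts these first. *)
Lemma uniform_sequence u c : nonincreasing_seq u -> 0 < c ->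
  (forall i, u i = 0 \/ u i = c) -> series u @ \oo --> (1 : R) ->
  exists n : nat, (0 < n)%N /\ forall i, u i = if (i < n)%N then n%:R^-1 else 0.
Proof.
move=> ud c0 uE u1.
have u0 : u @ \oo --> (0 : R).
  by apply: cvg_series_cvg_0; apply/cvg_ex; exists 1.
have ex : exists n, u n == 0.
  have /cvgrPdist_lt/(_ c c0)[N _ NP] := u0.
  exists N; have := NP N (leqnn N); rewrite /= sub0r normrN.
  by case: (uE N) => ->; rewrite ?eqxx // gtr0_norm // ltxx.
case: (ex_minnP ex) => n /eqP un nmin.
have uc i : u i = if (i < n)%N then c else 0.
  case: ltnP => [lt|ge].
    by case: (uE i) => // /eqP /nmin; rewrite leqNgt lt.
  case: (uE i) => // uic; have := ud _ _ ge.
  by rewrite un uic leNgt c0.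
have nc : c *+ n = 1 by apply: cvg_unique (series_step uc) u1.
have n0 : (0 < n)%N.
  by rewrite lt0n; apply/negP => /eqP n0; move: nc; rewrite n0 mulr0n => /eqP; rewrite eq_sym oner_eq0.
exists n; split=> // i; rewrite uc; case: ifP => // _.
have nn : n%:R != 0 :> R by rewrite pnatr_eq0 -lt0n.
by apply: (mulIf nn); rewrite mulr_natr nc mulVf.
Qed.
End Sums.

Definition homogeneous (R : realType) (k : thoma_param R) : Prop :=
  [\/ exists n : nat, (0 < n)%N /\
        [/\ forall i, alpha k i = if (i < n)%N then n%:R^-1 else 0,
            forall i, beta k i = 0 &
            gamma k = 0],
      exists n : nat, (0 < n)%N /\
        [/\ forall i, alpha k i = 0,
            forall i, beta k i = (if (i < n)%N then n%:R^-1 else 0) &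
            gamma k = 0] |
      forall i, alpha k i = 0 /\ beta k i = 0].

Section Thoma.
Variables (R : realType) (k : thoma_param R).

Lemma ge0_nneseries_cvg (f : nat -> R) : (forall i, 0 <= f i) ->
  (\sum_(0 <= i <oo) (f i)%:E <= 1)%E ->
  exists2 l, series f @ \oo --> l & (\sum_(0 <= i <oo) (f i)%:E = l%:E)%E.
Proof.
move=> f0 f1.
have cf : cvgn (series f).
  apply: nondecreasing_is_cvgn.
    by apply: nondecreasing_series => j _ _; exact: f0.
  exists 1 => _ [n _ <-]; rewrite -lee_fin; apply: le_trans f1.
  rewrite /series /= -sumEFin; apply: nneseries_lim_ge => i _ _.
  by rewrite lee_fin.
exists (limn (series f)) => //.
rewrite -EFin_lim //; congr (limn _); apply/funext => n.
by rewrite /= /series /= sumEFin.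
Qed.

Lemma thoma_sums : exists A B : R, [/\ series (alpha k) @ \oo --> A,
  series (beta k) @ \oo --> B & A + B + gamma k = 1].
Proof.
have s := thoma_sum k.
have a0 : (0 <= \sum_(0 <= i <oo) (alpha k i)%:E)%E.
  by apply: nneseries_ge0 => i _ _; rewrite lee_fin alpha_ge0.
have b0 : (0 <= \sum_(0 <= i <oo) (beta k i)%:E)%E.
  by apply: nneseries_ge0 => i _ _; rewrite lee_fin beta_ge0.
have g0 : (0 <= (gamma k)%:E)%E by rewrite lee_fin gamma_ge0.
have [|A cA EA] := @ge0_nneseries_cvg (alpha k) (@alpha_ge0 _ k).
  by rewrite -s -addeA leeDl // adde_ge0.
have [|B cB EB] := @ge0_nneseries_cvg (beta k) (@beta_ge0 _ k).
  by rewrite -s addeAC leeDr // adde_ge0.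
exists A, B; split=> //; move: s; rewrite EA EB -!EFinD => -[] //.
Qed.

Lemma ge0_series_expr (f : nat -> R) (l : R) q : (forall i, 0 <= f i) ->
  series f @ \oo --> l -> l <= 1 -> (0 < q)%N -> cvgn (series (fun i => f i ^+ q)).
Proof.
move=> f0 fl l1 q0.
have f1 i : f i <= 1 by apply: le_trans l1; exact: ge0_series_term_le.
apply: (@series_le_cvg _ _ f) => [i|//|i|]; first exact: exprn_ge0.
  by rewrite -{2}[f i]expr1 ler_wiXn2l.
by apply/cvg_ex; exists l.
Qed.

(** With [c = p_2], the nonnegative terms of
    [sum alpha (alpha - c)^2 + sum beta (beta + c)^2 + gamma c^2] add up to
    [p_3 - 2 c p_2 + c^2 = 0], the variance of the measure attached to [k]. *)
Lemma cycle3_homogeneous : thoma_cycle k 3 = thoma_cycle k 2 ^+ 2 ->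
  homogeneous k.
Proof.
have [A [B [cA cB AB]]] := thoma_sums.
have a0 := @alpha_ge0 _ k; have b0 := @beta_ge0 _ k; have g0 := gamma_ge0 k.
have sge0 (f : nat -> R) (l : R) : (forall i, 0 <= f i) -> series f @ \oo --> l -> 0 <= l.
  move=> f0 fl; rewrite -(cvg_lim _ fl) //; apply: limr_ge.
    by apply/cvg_ex; exists l.
  by near=> n; rewrite /series /= sumr_ge0.
have A0 := sge0 _ _ a0 cA; have B0 := sge0 _ _ b0 cB.
have ca q : (0 < q)%N -> exists l : R, series (fun i => alpha k i ^+ q) @ \oo --> l.
  by move=> q0; apply/cvg_ex/(ge0_series_expr a0 cA) => //; lra.
have cb q : (0 < q)%N -> exists l : R, series (fun i => beta k i ^+ q) @ \oo --> l.
  by move=> q0; apply/cvg_ex/(ge0_series_expr b0 cB) => //; lra.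
have [[a2 ca2] [a3 ca3]] := (ca 2%N isT, ca 3%N isT).
have [[b2 cb2] [b3 cb3]] := (cb 2%N isT, cb 3%N isT).
have sD (f g : nat -> R) (l m : R) : series f @ \oo --> l -> series g @ \oo --> m ->
    series (fun i => f i + g i) @ \oo --> l + m.
  move=> fl gm; rewrite (_ : series _ = series f + series g); first exact: cvgD.
  by apply/funext => n; rewrite /series /= big_split.
have sZ (f : nat -> R) (c l : R) : series f @ \oo --> l ->
    series (fun i => c * f i) @ \oo --> c * l.
  move=> fl; rewrite (_ : series _ = fun n => c * series f n); first exact: cvgMr.
  by apply/funext => n; rewrite /series /= mulr_sumr.
have -> : thoma_cycle k 2 = a2 - b2.
  apply: cvg_lim => //; rewrite (_ : (fun i => _) = (fun i => alpha k i ^+ 2 + (-1) * beta k i ^+ 2)).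
    by rewrite -[- b2]mulN1r; apply: (@sD) => //; exact: (@sZ).
  by apply/funext => i; ring.
have -> : thoma_cycle k 3 = a3 + b3.
  apply: cvg_lim => //; rewrite (_ : (fun i => _) = (fun i => alpha k i ^+ 3 + beta k i ^+ 3)).
    exact: (@sD).
  by apply/funext => i; ring.
set c := a2 - b2 => e3.
(* The part of the variance carried by the atoms other than [gamma]. *)
pose g i := alpha k i * (alpha k i - c) ^+ 2 + beta k i * (beta k i + c) ^+ 2.
have cg : series g @ \oo --> - (c ^+ 2 * gamma k).
  have -> : g = fun i => alpha k i ^+ 3 + (beta k i ^+ 3 + ((- 2 * c) * alpha k i ^+ 2
      + (2 * c * beta k i ^+ 2 + (c ^+ 2 * alpha k i + c ^+ 2 * beta k i)))).
    by apply/funext => i; rewrite /g; ring.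
  have -> : - (c ^+ 2 * gamma k) =
     a3 + (b3 + (- 2 * c * a2 + (2 * c * b2 + (c ^+ 2 * A + c ^+ 2 * B)))).
    have -> : gamma k = 1 - A - B by rewrite -AB; ring.
    have -> : a3 = (c ^+ 2 - b3) by rewrite -e3; ring.
    have -> : a2 = c + b2 by rewrite /c; ring.
    by ring.
  apply: (@sD) => //; apply: (@sD) => //; apply: (@sD); first exact: (@sZ).
  by apply: (@sD); [exact: (@sZ)|apply: (@sD); exact: (@sZ)].
have pa i : 0 <= alpha k i * (alpha k i - c) ^+ 2 by rewrite mulr_ge0 // sqr_ge0.
have pb i : 0 <= beta k i * (beta k i + c) ^+ 2 by rewrite mulr_ge0 // sqr_ge0.
have gge i : 0 <= g i by rewrite addr_ge0.
have gl := sge0 _ _ gge cg.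
have cg0 : 0 <= c ^+ 2 * gamma k by rewrite mulr_ge0 // sqr_ge0.
have g00 : - (c ^+ 2 * gamma k) <= 0 by lra.
have gi := ge0_series_eq0 gge cg g00.
have ai i : alpha k i = 0 \/ alpha k i = c.
  have /eqP := gi i; rewrite /g paddr_eq0 // => /andP[+ _].
  rewrite mulf_eq0 sqrf_eq0 subr_eq0 => /orP[/eqP ->|/eqP ->]; by [left|right].
have bi i : beta k i = 0 \/ beta k i = - c.
  have /eqP := gi i; rewrite /g paddr_eq0 // => /andP[_ +].
  rewrite mulf_eq0 sqrf_eq0 addr_eq0 => /orP[/eqP ->|/eqP ->]; by [left|right].
have gc : c != 0 -> gamma k = 0.
  move=> c0; have /eqP : c ^+ 2 * gamma k = 0 by lra.
  by rewrite mulf_eq0 sqrf_eq0 (negPf c0) => /eqP.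
have s0 (f : nat -> R) (l : R) : (forall i, f i = 0) -> series f @ \oo --> l -> l = 0.
  move=> f0 fl; have fE i : f i = if (i < 0)%N then 0 else 0 by rewrite f0.
  by rewrite -(cvg_lim _ fl) // (cvg_lim _ (@series_step _ f 0 0 fE)).
have [c0|c0|c0] := ltgtP c 0.
- have al0 i : alpha k i = 0 by case: (ai i) => // h; have := a0 i; rewrite h leNgt c0.
  constructor 2; have [n [n0 nP]] : exists n : nat, (0 < n)%N /\
      forall i, beta k i = if (i < n)%N then n%:R^-1 else 0.
    apply: (@uniform_sequence _ _ (- c)); [exact: beta_noninc|lra|exact: bi|].
    by have := cB; rewrite (_ : B = 1) // -AB (s0 _ _ al0 cA) gc ?lt_eqF //; ring.
  by exists n; split=> //; split=> //; rewrite gc ?lt_eqF.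
- have be0 i : beta k i = 0 by case: (bi i) => // h; have := b0 i; rewrite h; lra.
  constructor 1; have [n [n0 nP]] : exists n : nat, (0 < n)%N /\
      forall i, alpha k i = if (i < n)%N then n%:R^-1 else 0.
    apply: (@uniform_sequence _ _ c); [exact: alpha_noninc|lra|exact: ai|].
    by have := cA; rewrite (_ : A = 1) // -AB (s0 _ _ be0 cB) gc ?gt_eqF //; ring.
  by exists n; split=> //; split=> //; rewrite gc ?gt_eqF.
- constructor 3 => i; split.
    by case: (ai i) => ->.
  by case: (bi i) => ->; rewrite ?c0 ?oppr0.
Unshelve. all: by end_near. Qed.

(** All atoms sit at one point [c], and they carry the whole mass unless [c = 0],
    so the [q]-th power sum is [c ^ (q - 1)]. *)
Lemma thoma_cycle_geometric : homogeneous k ->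
  forall q, (1 < q)%N ->
  thoma_cycle k q.+1 = thoma_cycle k 2 * thoma_cycle k q.
Proof.
(* [d q] is the common value of the [n] nonzero terms of the [q]-th power sum. *)
suff main c n (d : nat -> R) : (forall q, (1 < q)%N ->
    d q *+ n = c ^+ q.-1 /\
    forall i, alpha k i ^+ q - (- beta k i) ^+ q = if (i < n)%N then d q else 0) ->
    forall q, (1 < q)%N -> thoma_cycle k q.+1 = thoma_cycle k 2 * thoma_cycle k q.
  case=> [[n [n0 [aE bE _]]]|[n [n0 [aE bE _]]]|abE].
  - apply: (main n%:R^-1 n (fun q => n%:R^-1 ^+ q)) => -[//|q] q1; split=> [|i].
      by rewrite exprS -mulrnAl -[_ *+ n]mulr_natr mulVf ?mul1r // pnatr_eq0 -lt0n.
    by rewrite aE bE oppr0 [0 ^+ _]expr0n subr0; case: ifP => // _; rewrite expr0n.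
  - apply: (main (- n%:R^-1) n (fun q => - (- n%:R^-1) ^+ q)) => -[//|q] q1; split=> [|i].
      rewrite exprS mulNr opprK -mulrnAl -[_ *+ n]mulr_natr mulVf ?mul1r //.
      by rewrite pnatr_eq0 -lt0n.
    rewrite aE bE expr0n sub0r; case: ifP => // _.
    by rewrite oppr0 expr0n oppr0.
  - apply: (main 0 0 (fun=> 0)) => -[//|[//|q]] q1; split=> [|i].
      by rewrite expr0n.
    by have [-> ->] := abE i; rewrite oppr0 subrr.
move=> dP q q1.
have cE p : (1 < p)%N -> thoma_cycle k p = c ^+ p.-1.
  move=> p1; have [<- dE] := dP p p1; apply: cvg_lim => //.
  exact: series_step.
rewrite !cE //; last exact: ltnW.
by case: q q1 => // q _; exact: exprS.
Qed.
End Thoma.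

(** * The Gelfand-Naimark-Segal representation *)

Section GNS.
Variables (R : realType) (k : thoma_param R) (H : completeNormedModType R[i]).
Variables (dot : {dot H for conjC}) (pi : finperm -> H -> H) (xi : H).
Hypothesis gns : GNS_triple dot (thoma_char k) pi xi.
Local Notation tau := (thoma_char k).
Local Notation rdot := (re_dot dot).
Local Notation rnorm := (@re_norm R H).

Let hd : hilbert_dot dot. Proof. by case: gns. Qed.
Let pr : unitary_rep dot pi. Proof. by case: gns. Qed.
Let dn : dense (linear_span (range (pi ^~ xi))). Proof. by case: gns. Qed.

Lemma dot_orbit s t : dot (pi s xi) (pi t xi) = (tau (t^-1 * s)%g)%:C%C.
Proof.
case: gns => _ _ _ <-.
by rewrite (repM pr) [RHS](rep_adjoint pr) invgK.
Qed.

Lemma dot_orbit1 s : dot (pi s xi) xi = (tau s)%:C%C.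
Proof. by case: gns. Qed.

Lemma rdot_orbit s t : rdot (pi s xi) (pi t xi) = tau (t^-1 * s)%g.
Proof. by rewrite /re_dot dot_orbit. Qed.

Lemma rnorm_orbit s : rnorm (pi s xi) = 1.
Proof.
apply/eqP; rewrite -(@eqrXn2 _ 2) ?rnorm_ge0 //.
by rewrite (rnorm2 hd) rdot_orbit mulVg thoma_char1 expr1n.
Qed.

Lemma bounded_orbit_eq (T1 T2 : H -> H) :
  bounded_operator T1 -> bounded_operator T2 ->
  (forall g, T1 (pi g xi) = T2 (pi g xi)) -> T1 = T2.
Proof.
move=> b1 b2 e; apply: (bounded_dense_eq b1 b2 dn) => x /span_lincomb[l ->].
rewrite /lincomb (lin_sum b1.1) (lin_sum b2.1); apply: eq_bigr => p _.
by rewrite (linZ b1.1) (linZ b2.1) e.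
Qed.

Lemma orbit_ortho x : (forall g, dot x (pi g xi) = 0) -> x = 0.
Proof.
move=> x0; apply/rnorm_eq0/eqP; rewrite -sqrf_eq0; apply/eqP.
apply: (@le_small_eq0 _ _ (rnorm x)); first by rewrite sqr_ge0.
move=> e e0; have [_ /span_lincomb[l ->] xl] := denseP dn x e0.
have -> : rnorm x ^+ 2 = rdot x (x - lincomb (pi^~ xi) l).
  rewrite (rnorm2 hd) rdotBr [rdot x (lincomb _ _)](_ : _ = 0) ?subr0 //.
  rewrite /re_dot linear_sumr big1 // => p _.
  by rewrite linearZr_LR /= x0 mulr0.
apply: le_trans (ler_norm _) _; apply: le_trans (cauchy_schwarz hd _ _) _.
by rewrite ler_wpM2l ?rnorm_ge0 // ltW.
Qed.

(** For large [m] and [n] the transposition [(m n)] commutes with [a] and [b] and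
    conjugates [(0 m)] to [(0 n)], and [tau] is a class function. *)
Lemma thoma_char_swap_stable a b :
  evconst (fun n => tau (a * swap 0 n.+1 * b)%g).
Proof.
have [K KP] := finperm_bounded a; have [L LP] := finperm_bounded b.
set N := maxn K L; exists (tau (a * swap 0 N.+1 * b)%g), N => n Nn.
have fixab m : (N <= m)%N -> a m.+1 = m.+1 /\ b m.+1 = m.+1.
  rewrite /N geq_max => /andP[Km Lm].
  by split; [apply: KP|apply: LP]; exact: leqW.
have [aN bN] := fixab _ (leqnn N); have [an bn] := fixab _ Nn.
set u := swap N.+1 n.+1.
have au : (a * u = u * a)%g by rewrite -swap_commute.
have ub : (u^-1 * b = b * u^-1)%g.
  by apply: (@mulgI _ u); rewrite mulVKg mulgA swap_commute // -mulgA mulgV mulg1.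
rewrite -[RHS](thoma_char_conj k _ u); congr tau.
by rewrite -(@swap_conj N.+1 n.+1) // -/u !mulgA au -!mulgA ub.
Qed.

(** Matrix coefficients of the transpositions [(0 n)] stabilise on the dense span
    of the orbit of [xi].  The limit is the operator by which Okounkov recovers
    the Thoma parameters: its moments at [xi] are the numbers
    [p_2, p_3, ...]. *)
Lemma okounkov_operator : exists2 A : H -> H, bounded_operator A &
  forall x y, (fun n => rdot y (pi (swap 0 n.+1) x)) @ \oo --> rdot y (A x).
Proof.
apply: (@weak_limit _ _ dot hd (fun n => pi (swap 0 n.+1)) _ _ _ dn) => [n|n x|x y].
- exact: rep_linear pr _.
- by rewrite (rep_rnorm hd pr).
move=> /span_lincomb[l ->] /span_lincomb[l' ->].
apply: (evconst_comp (@complex.Re R)).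
rewrite /lincomb; elim: l => [|[c g] l IH].
  by exists 0, 0%N => n _; rewrite big_nil (lin0 (rep_linear pr _)) linear0r.
have -> : (fun n => dot (\sum_(p <- l') p.1 *: pi p.2 xi)
     (pi (swap 0 n.+1) (\sum_(p <- (c, g) :: l) p.1 *: pi p.2 xi))) =
  (fun n => c^*%C * dot (\sum_(p <- l') p.1 *: pi p.2 xi) (pi (swap 0 n.+1) (pi g xi)) +
     dot (\sum_(p <- l') p.1 *: pi p.2 xi)
     (pi (swap 0 n.+1) (\sum_(p <- l) p.1 *: pi p.2 xi))).
  apply/funext => n; rewrite big_cons (rep_linear pr) linearDr linearZr_LR //=.
apply: (evconst_comp2 (fun a b => a + b)) IH.
apply: (evconst_comp (fun a => c^*%C * a)).
elim: l' => [|[d h] l' IH].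
  by exists 0, 0%N => n _; rewrite big_nil linear0l.
have -> : (fun n => dot (\sum_(p <- (d, h) :: l') p.1 *: pi p.2 xi)
     (pi (swap 0 n.+1) (pi g xi))) =
  (fun n => d * dot (pi h xi) (pi (swap 0 n.+1) (pi g xi)) +
     dot (\sum_(p <- l') p.1 *: pi p.2 xi) (pi (swap 0 n.+1) (pi g xi))).
  by apply/funext => n; rewrite big_cons linearDl linearZl_LR.
apply: (evconst_comp2 (fun a b => a + b)) IH.
apply: (evconst_comp (fun a => d * a)).
have [t [N NP]] := thoma_char_swap_stable (g^-1)%g h.
exists (t%:C%C), N => n Nn.
by rewrite -(repM pr) dot_orbit invgM swapV (NP n Nn).
Qed.

(** The scalar [c] is [<A xi, xi> = lim tau (0 n) = p_2], and
    [<A xi, pi (0 1) xi>] is both [c p_2] and the limit [p_3] of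
    [tau ((0 n) (0 1))]. *)
Lemma irreducible_cycle3 : irreducible_inclusion (N_alg dot pi) (M_alg pi) ->
  thoma_cycle k 3 = thoma_cycle k 2 ^+ 2.
Proof.
move=> /(irreducibleP hd pr) irr.
have [A Ab AP] := okounkov_operator.
have AN : commutant (pi @` stab0) A.
  split=> // _ [s s0 <-]; apply/funext => x; apply: (rdot_inj hd) => y /=.
  have h1 := AP (pi s x) y.
  have h2 := AP x (pi s^-1%g y).
  have <- : rdot (pi s^-1%g y) (A x) = rdot y (pi s (A x)).
    by rewrite /re_dot (rep_adjoint pr) invgK.
  have [K KP] := finperm_bounded s.
  apply: (@cvg_eq _ _ _ _ _ K) h1 h2 => n Kn.
  rewrite -(repM pr) swap_commute ?(repM pr) //; last by apply: KP; exact: leqW.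
  by rewrite [RHS]/re_dot (rep_adjoint pr) invgK.
have AM : M_alg pi A.
  split=> // S [Sb SP]; apply/funext => x; apply: (rdot_inj hd) => y /=.
  have [S' _ S'P] := adjointP hd Sb.
  have adj u v : rdot v (S u) = rdot (S' v) u.
    by rewrite rdotC /re_dot S'P -/(rdot u (S' v)) rdotC.
  rewrite adj; apply: (@cvg_eq _ _ _ _ _ 0) (AP (S x) y) (AP x (S' y)) => n _.
  by rewrite -adj; congr rdot; have /(congr1 (@^~ x)) := SP _ (imageT pi (swap 0 n.+1)).
have [c cE] := irr A AN AM.
have e s : rdot (pi s xi) (A xi) = complex.Re c * tau s.
  rewrite cE /re_dot linearZr_LR /= dot_orbit1.
  by case: (c) => a b /=; rewrite !mulr0 subr0.
have lim s v : (forall n, (0 < n)%N -> tau (swap 0 n.+1 * s)%g = v) -> rdot (pi s xi) (A xi) = v.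
  move=> h; apply: (@cvg_eq _ _ (fun=> v) _ _ 1) (AP xi (pi s xi)) (cvg_cst _) => n n0.
  by rewrite rdot_orbit swapV (h n n0).
have cp2 : complex.Re c = thoma_cycle k 2.
  rewrite -(lim 1%g (thoma_cycle k 2)) ?e ?thoma_char1 ?mulr1 // => n _.
  by rewrite mulg1 thoma_char_swap.
rewrite expr2 -{1}cp2 -(@thoma_char_swap _ k 1) // -e.
apply/esym/lim => n n0; apply: thoma_char_swap2 => //.
by rewrite eqSS -lt0n.
Qed.

Section Irreducible.
Hypothesis tauM : forall s t : finperm,
  (forall n, n != 0%N -> s n = n \/ t n = n) -> tau (s * t)%g = tau s * tau t.

(** Right translation by [h^-1] preserves the Gram matrix of the orbit because
    [tau] is invariant under conjugation by [h]. *)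
Lemma right_translation h : exists U : H -> H,
  [/\ commutant (range pi) U, forall g, U (pi g xi) = pi (g * h^-1)%g xi &
   forall x y, dot (U x) (U y) = dot x y].
Proof.
have [|U [Ub Uv Ui]] := @isometry_extension _ _ dot hd _ (pi^~ xi)
    (fun g => pi (g * h^-1)%g xi) dn.
  move=> i j; rewrite !dot_orbit; congr _%:C%C.
  by rewrite invgM invgK -[LHS](thoma_char_conj k _ h) !mulgA.
exists U; split=> //; split=> // _ [s _ <-].
have pb := rep_bounded hd pr s.
apply: bounded_orbit_eq => [||g /=].
- exact: bounded_comp.
- exact: bounded_comp.
by rewrite -(repM pr) !Uv -(repM pr) mulgA.
Qed.

(** [pi h \o U] is the unitary conjugation by [h], and [eta] is invariant under
    all conjugations fixing [0].  For a suitable [h] the conjugate of [a] is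
    independent, in the sense of [tauM], of every permutation occurring in an
    approximation of [eta]. *)
Lemma conj_invariant_rdot eta a :
  (forall (h : finperm) (U : H -> H), h 0%N = 0%N -> commutant (range pi) U ->
     (forall g, U (pi g xi) = pi (g * h^-1)%g xi) ->
     pi h (U eta) = eta) ->
  rdot eta (pi a xi) = rdot eta ((tau a^-1%g)%:C%C *: xi).
Proof.
move=> inv; apply/eqP; rewrite -subr_eq0; apply/eqP/normr0_eq0.
set t := tau a^-1%g.
apply: (@le_small_eq0 _ _ (1 + `|t|)) => // e e0.
have [_ /span_lincomb[l ->] el] := denseP dn eta e0.
set v := lincomb _ _ in el.
have [N NP] : exists N, forall n p, (N <= n)%N -> p \in l -> p.2 n = n.
  elim: (l) => [|[c g] l' [N NP]]; first by exists 0%N.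
  have [K KP] := finperm_bounded g.
  exists (maxn K N) => n p; rewrite geq_max inE => /andP[Kn Nn] /orP[/eqP ->|pl].
    exact: KP.
  exact: NP.
(* [h] depends on the approximation [v], hence on [e]; [b] is the conjugate. *)
have [K KP] := finperm_bounded a^-1%g.
have [h h0 hP] := exists_shift K N.
have [U [UC Uv Ui]] := right_translation h.
pose b := (h * a * h^-1)%g.
have shift x : rdot x (pi a xi) = rdot (pi h (U x)) (pi b xi).
  rewrite /re_dot /b -mulgA (repM pr) (rep_dot pr) -Uv Ui //.
have vb : rdot v (pi b xi) = rdot v (t%:C%C *: xi).
  rewrite /re_dot; congr complex.Re.
  rewrite /v /lincomb !linear_sumlz; apply: eq_big_seq => p pl.
  rewrite !linearZl_LR linearZr_LR /= dot_orbit dot_orbit1.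
  rewrite tauM => [|n n0].
    have -> : tau b^-1%g = t.
      by rewrite /b !invgM invgK mulgA thoma_char_conj.
    congr (_ * _); rewrite rmorphM /=; congr (_ * _).
    by apply/eqP; rewrite eq_complex /= oppr0 !eqxx.
  case: (leqP N n) => [Nn|nN]; first by right; exact: NP.
  left; rewrite /b !invgM invgK !finpermME.
  set x := (h^-1)%g n.
  have hx : h x = n by rewrite finpermVK.
  rewrite KP ?finpermVK // leqNgt; apply/negP => xK.
  have x0 : (0 < x)%N.
    by rewrite lt0n; apply: contra_neq n0 => x0; rewrite -hx x0.
  by have := hP x; rewrite x0 xK hx leqNgt nN => /(_ isT).
have -> : rdot eta (pi a xi) - rdot eta (t%:C%C *: xi) =
  rdot (eta - v) (pi b xi) - rdot (eta - v) (t%:C%C *: xi).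
  rewrite shift (inv h U) // !rdotBl vb; ring.
apply: le_trans (ler_normB _ _) _; rewrite mulrDl lerD //.
  apply: le_trans (cauchy_schwarz hd _ _) _.
  by rewrite rnorm_orbit mulr1 mul1r ltW.
apply: le_trans (cauchy_schwarz hd _ _) _.
rewrite rnormZ_real -{1}(rep1 pr xi) rnorm_orbit mulr1 mulrC.
by rewrite ler_wpM2l // ltW.
Qed.

(** A [T] in [M] commutes with the right translations and with [N], so [T xi] is
    invariant under conjugations fixing [0]; the previous lemma, applied to
    [T xi] and to [i *: T xi], shows that [T xi - lambda *: xi] is orthogonal to
    the orbit of [xi].  Right translations then spread [T xi = lambda *: xi] over
    the orbit. *)
Lemma irreducible_of_mul : irreducible_inclusion (N_alg dot pi) (M_alg pi).
Proof.
apply/(irreducibleP hd pr) => T [Tb TN] [_ TM].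
have Tinv c (h : finperm) (U : H -> H) : h 0%N = 0%N -> commutant (range pi) U ->
     (forall g, U (pi g xi) = pi (g * h^-1)%g xi) ->
     pi h (U (c *: T xi)) = c *: T xi.
  move=> h0 UC Uv.
  have /(congr1 (@^~ (c *: xi))) /= e1 := TM _ UC.
  have /(congr1 (@^~ (U (c *: xi)))) /= e2 := TN _ (ex_intro2 _ _ h h0 erefl).
  rewrite -(linZ Tb.1) -e1 -e2; congr T.
  have Ul := UC.1.1; rewrite (linZ Ul) (linZ (rep_linear pr h)); congr (_ *: _).
  by rewrite -{1}(rep1 pr xi) Uv mul1g -(repM pr) mulgV (rep1 pr).
have Tdot a : dot (T xi) (pi a xi) = dot (T xi) ((tau a^-1%g)%:C%C *: xi).
  apply: rdot_dot.
    by rewrite -[T xi]scale1r; apply: conj_invariant_rdot => h U; exact: Tinv.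
  by apply: conj_invariant_rdot => h U; exact: Tinv.
have Txi : T xi = dot (T xi) xi *: xi.
  apply/eqP; rewrite -subr_eq0; apply/eqP/orbit_ortho => a.
  rewrite linearBl linearZl_LR /= Tdot linearZr_LR /=.
  have -> : dot xi (pi a xi) = (tau a^-1%g)%:C%C.
    by rewrite -{1}(rep1 pr xi) dot_orbit mulg1.
  rewrite mulrC.
  by rewrite (_ : _^* = (tau a^-1%g)%:C%C) ?subrr //; apply/eqP; rewrite eq_complex /= oppr0 !eqxx.
exists (dot (T xi) xi); apply: bounded_orbit_eq => // [|g].
  exact: bounded_scale.
have [U [UC Uv _]] := right_translation g^-1%g.
have -> : pi g xi = U xi by rewrite -{2}(rep1 pr xi) Uv mul1g invgK.
have /(congr1 (@^~ xi)) /= -> := TM _ UC.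
by rewrite {1}Txi (linZ UC.1.1).
Qed.
End Irreducible.
End GNS.

Theorem theorem1 (R : realType) (k : thoma_param R)
    (H : completeNormedModType R[i]) (dot : {dot H for conjC})
    (pi : finperm -> H -> H) (xi : H)
    (gns : GNS_triple dot (thoma_char k) pi xi) :
  irreducible_inclusion (N_alg dot pi) (M_alg pi) <->
  [\/ exists n : nat, (0 < n)%N /\
        [/\ forall i, alpha k i = if (i < n)%N then n%:R^-1 else 0,
            forall i, beta k i = 0 &
            gamma k = 0],
      exists n : nat, (0 < n)%N /\
        [/\ forall i, alpha k i = 0,
            forall i, beta k i = (if (i < n)%N then n%:R^-1 else 0) &
            gamma k = 0] |
      forall i, alpha k i = 0 /\ beta k i = 0].
Proof.
split=> [/(irreducible_cycle3 gns)|hom]; first exact: cycle3_homogeneous.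
apply: (irreducible_of_mul gns); apply: thoma_char_mul.
exact: thoma_cycle_geometric.
Qed.
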